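(* Let $R>0$, $\gamma>1$, $\alpha>0$, $p=R\rho\theta$, $e=\frac{R}{\gamma-1}\theta$, $g(\theta)=\sigma\theta^\alpha$. Let $(\rho_\pm,u_\pm,\theta_\pm)$ and $c\in\mathbb{R}$ satisfy the Rankine--Hugoniot conditions and the entropy condition for 1-shocks stated in the context, let $(\rho,u,\theta,n)$ be the corresponding shock wave profile (see the context), and let $$\delta:=\frac{|U_+-U_-|}{U_c},\qquad U_\pm:=u_\pm-c,\qquad U_c:=\frac{U_++U_-}{2}.$$ (i) If $\gamma<2$, the profile is discontinuous in the components $\rho$, $u$ and $\theta$ if $$\delta\ge\delta_{\mathrm{jump}}:=\frac{2(\gamma-1)}{\gamma}.$$ (ii) The components $\rho$ and $u$ of the profile are always monotone, while the temperature profile $\theta$ is monotone if and only if $\gamma<3$ and $$\delta\le\delta_{\mathrm{spike}}:=\frac{\gamma-1}{\gamma}.$$ If this condition is not satisfied, the temperature profile has a single internal absolute maximum point, which can be either attained at the jump point or at some point of regularity.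
   Context: Consider the system $$\begin{cases}\partial_t\rho+\partial_x(\rho u)=0,\\ \partial_t(\rho u)+\partial_x(\rho u^2+p)=0,\\ \partial_t(\rho E)+\partial_x(\rho E u+p u-\sigma_s^{-1}\partial_x n)=0,\\ \partial_x^2 n=\tau^2(n-g(\theta))\end{cases}$$ for density $\rho>0$, velocity $u$, temperature $\theta>0$ and radiation intensity $n$, where $E=\frac12u^2+e$ and $\sigma,\sigma_s,\tau$ are positive constants. The asymptotic states have $\rho_\pm>0$, $\theta_\pm>0$. Writing $[h]:=h_+-h_-$, the Rankine--Hugoniot conditions are $$c[\rho]=[\rho u],\qquad c[\rho u]=[\rho u^2+p],\qquad c[\rho E]=[\rho E u+p u],$$ and the entropy condition for 1-shocks is $$c+\sqrt{R\gamma\theta_-}<u_-,\qquad c<u_+<c+\sqrt{R\gamma\theta_+}.$$ The shock wave profile is the solution of the form $(\rho,u,\theta,n)(x-ct)$ with $(\rho,u,\theta,n,\partial_xn)(\pm\infty)=(\rho_\pm,u_\pm,\theta_\pm,g(\theta_\pm),0)$; under the stated conditions it exists, is unique up to translations, and has at most one discontinuity point. Solutions are understood as follows, with $\xi=x-ct$ and $U:=u-c$: $\rho,u,\theta$ are continuous and piecewise $C^1$ in $\xi$ except possibly at finitely many jump points, where they have left limits (subscript $\ell$) and right limits (subscript $r$); $n$ and $dn/d\xi$ are continuous; the equations $$\frac{d}{d\xi}(\rho U)=0,\quad \frac{d}{d\xi}(\rho U^2+p)=0,\quad \frac{d}{d\xi}\Bigl(\rho U\bigl(\tfrac12U^2+e\bigr)+pU-\frac1{\sigma_s}\frac{dn}{d\xi}\Bigr)=0,\quad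 \frac{d^2n}{d\xi^2}=\tau^2(n-g(\theta))$$ hold in the weak sense; and each jump satisfies $\sqrt{R\gamma\theta_\ell}<U_\ell$ and $0<U_r<\sqrt{R\gamma\theta_r}$. If $\theta$ is discontinuous at the jump point, ''maximum attained at the jump point'' refers to the one-sided limits there. As a consequence of the entropy conditions, $\delta$ always belongs to $(0,2/\gamma)$.
   Formalization: The condition for monotone θ is corrected from ''γ<3 and δ≤δ_spike'' to ''γ≥3 or δ≤δ_spike'', and its negation is used for the interior maximum; for γ≥3, δ<2/γ≤δ_spike always holds and θ is monotone, so the printed condition fails there. *)

(* Defs.v *)
From Stdlib Require Import Reals List.
From Coquelicot Require Import Coquelicot.
Open Scope R_scope.

Record medium : Type := Medium {
  gasR : R; gam : R; alpha : R; sigma : R; sigma_s : R; tau : R }.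

Definition medium_ok (M : medium) : Prop :=
  0 < gasR M /\ 1 < gam M /\ 0 < alpha M /\
  0 < sigma M /\ 0 < sigma_s M /\ 0 < tau M.

Definition pressure (M : medium) (rho th : R) : R := gasR M * rho * th.

Definition internal_energy (M : medium) (th : R) : R :=
  gasR M / (gam M - 1) * th.

Definition total_energy (M : medium) (v th : R) : R :=
  v ^ 2 / 2 + internal_energy M th.

Definition emission (M : medium) (th : R) : R := sigma M * Rpower th (alpha M).

Record state : Type := State { density : R; velocity : R; temperature : R }.

Definition state_ok (S : state) : Prop := 0 < density S /\ 0 < temperature S.

Definition rankine_hugoniot (M : medium) (Sm Sp : state) (c : R) : Prop :=
  let p S := pressure M (density S) (temperature S) in
  let E S := total_energy M (velocity S) (temperature S) in
  let jmp (h : state -> R) := h Sp - h Sm in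
  c * jmp density = jmp (fun S => density S * velocity S) /\
  c * jmp (fun S => density S * velocity S)
    = jmp (fun S => density S * velocity S ^ 2 + p S) /\
  c * jmp (fun S => density S * E S)
    = jmp (fun S => density S * E S * velocity S + p S * velocity S).

Definition sound_speed (M : medium) (th : R) : R := sqrt (gasR M * gam M * th).

Definition one_shock_entropy (M : medium) (Sm Sp : state) (c : R) : Prop :=
  c + sound_speed M (temperature Sm) < velocity Sm /\
  c < velocity Sp < c + sound_speed M (temperature Sp).

Definition shock_strength (Sm Sp : state) (c : R) : R :=
  let Um := velocity Sm - c in
  let Up := velocity Sp - c in
  Rabs (Up - Um) / ((Up + Um) / 2).

Definition delta_jump (M : medium) : R := 2 * (gam M - 1) / gam M.

(* The shock strength is always < 2 / gam.  Hence delta_jump can be reached only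
   if gam < 2, and delta_spike can be exceeded only if gam < 3. *)
Definition delta_spike (M : medium) : R := (gam M - 1) / gam M.

Definition left_lim (f : R -> R) (x l : R) : Prop :=
  filterlim f (at_left x) (locally l).

Definition right_lim (f : R -> R) (x l : R) : Prop :=
  filterlim f (at_right x) (locally l).

(* Break points are locally finite, and the derivative has finite one-sided
   limits at each of them (elsewhere the second clause follows from the
   first). *)
Definition piecewise_C1 (f : R -> R) : Prop :=
  (forall a b : R, exists B : list R,
     forall x, a < x < b -> ~ In x B ->
       ex_derive f x /\ continuous (Derive f) x) /\
  (forall x, (exists l, left_lim (Derive f) x l) /\
             (exists r, right_lim (Derive f) x r)).

Definition test_function (a b : R) (phi : R -> R) : Prop :=
  (forall (k : nat) (x : R), ex_derive_n phi k x) /\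
  (forall x, x < a \/ b < x -> phi x = 0).

(* F' = G in the sense of distributions. *)
Definition weak_derivative (F G : R -> R) : Prop :=
  forall (a b : R) (phi : R -> R), a < b -> test_function a b phi ->
    is_RInt (fun x => F x * Derive phi x + G x * phi x) a b 0.

(* Functions of xi = x - c t.  The list [jumps] is exactly the set of jump
   points; the values of rho, u, theta at these points are immaterial. *)
Record profile : Type := Profile {
  rho : R -> R; u : R -> R; theta : R -> R; n : R -> R; jumps : list R }.

Definition profile_regular (P : profile) : Prop :=
  (forall x, ~ In x (jumps P) ->
     continuous (rho P) x /\ continuous (u P) x /\ continuous (theta P) x) /\
  piecewise_C1 (rho P) /\ piecewise_C1 (u P) /\ piecewise_C1 (theta P) /\
  (forall x, ex_derive (n P) x /\ continuous (Derive (n P)) x).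

Definition profile_positive (P : profile) : Prop :=
  forall x, ~ In x (jumps P) -> 0 < rho P x /\ 0 < theta P x.

Definition entropic_jumps (M : medium) (c : R) (P : profile) : Prop :=
  forall x, In x (jumps P) ->
    exists rl rr ul ur tl tr : R,
      left_lim (rho P) x rl /\ right_lim (rho P) x rr /\
      left_lim (u P) x ul /\ right_lim (u P) x ur /\
      left_lim (theta P) x tl /\ right_lim (theta P) x tr /\
      sound_speed M tl < ul - c /\
      0 < ur - c < sound_speed M tr.

Definition profile_equations (M : medium) (c : R) (P : profile) : Prop :=
  let U x := u P x - c in
  let p x := pressure M (rho P x) (theta P x) in
  let zero (_ : R) := 0 in
  weak_derivative (fun x => rho P x * U x) zero /\
  weak_derivative (fun x => rho P x * U x ^ 2 + p x) zero /\
  weak_derivative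
    (fun x => rho P x * U x * total_energy M (U x) (theta P x) + p x * U x
              - / sigma_s M * Derive (n P) x) zero /\
  weak_derivative (Derive (n P))
    (fun x => tau M ^ 2 * (n P x - emission M (theta P x))).

Definition profile_limit (M : medium) (S : state) (P : profile) (z : Rbar)
    : Prop :=
  is_lim (rho P) z (density S) /\
  is_lim (u P) z (velocity S) /\
  is_lim (theta P) z (temperature S) /\
  is_lim (n P) z (emission M (temperature S)) /\
  is_lim (Derive (n P)) z 0.

Definition shock_profile (M : medium) (Sm Sp : state) (c : R) (P : profile)
    : Prop :=
  profile_regular P /\ profile_positive P /\ entropic_jumps M c P /\
  profile_equations M c P /\
  profile_limit M Sm P m_infty /\ profile_limit M Sp P p_infty.

Definition jump_discontinuity (f : R -> R) (x : R) : Prop :=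
  exists l r : R, left_lim f x l /\ right_lim f x r /\ l <> r.

Definition monotone_off (J : list R) (f : R -> R) : Prop :=
  (forall x y, ~ In x J -> ~ In y J -> x < y -> f x <= f y) \/
  (forall x y, ~ In x J -> ~ In y J -> x < y -> f y <= f x).

(* At points where f is continuous this just says v = f x. *)
Definition one_sided_value (f : R -> R) (x v : R) : Prop :=
  left_lim f x v \/ right_lim f x v.

(* [x0] is the only maximum point on the extended line, whose two endpoints
   carry the values fm and fp; at a jump point the two one-sided limits play
   the role of the values of f. *)
Definition internal_absolute_max (f : R -> R) (fm fp x0 v0 : R) : Prop :=
  one_sided_value f x0 v0 /\
  (forall v, one_sided_value f x0 v -> v <= v0) /\
  (forall x v, x <> x0 -> one_sided_value f x v -> v < v0) /\
  fm < v0 /\ fp < v0.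

(* Main.v *)
Require Import Defs.
From Stdlib Require Import Reals Factorial List Lra Psatz Classical.
From Coquelicot Require Import Coquelicot.
Open Scope R_scope.

(** Put [U = u - c].  The three conservation laws integrate: [rho U = m], then
    [R theta = U (Q - U)] for a constant [Q], and the energy law becomes
    [n' = A (h ^ 2 - v ^ 2)] with [v = U - Uc], where [Uc] is the mean of the two
    end velocities, [Uc + h] and [Uc - h] are these velocities, and
    [Q = (gam + 1) / gam * Uc].  The value [v = 0] is exactly the sonic one, so
    [v > 0] is supersonic, [v < 0] subsonic, and a jump goes from some [s > 0] to
    [- s].  What is left is the system [n' = w], [w' = tau ^ 2 (n - g(theta))]
    with [w = A (h ^ 2 - v ^ 2)] ([reduced]).

    Off the sonic value [w'' = tau ^ 2 w] wherever [w' = 0], so [w] has no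
    positive maximum and no negative minimum there ([critical_escape]).  A jump
    heats the gas, so [w'] drops across it and a jump is no minimum either.  As
    [w] vanishes at both ends, [w >= 0] ([w_nonneg]) and [n] increases.  At a
    regular sonic point [w] is largest, whence [n = g(theta)] there; comparing
    the increasing [n] with [g(theta)] on either side shows that such a point is
    crossed only from supersonic to subsonic.  Hence the profile is supersonic
    up to one point and subsonic after it ([transition_exists]).  On each side
    [w] is monotone, so [v] decreases throughout, strictly on the subsonic side,
    and [u] and [rho = m / U] are monotone.

    If the transition is a regular sonic point, [n] equals the sonic value of
    [g] there and grows strictly to [g(theta_+)], so [theta_+] exceeds the sonic
    temperature; as [U (Q - U)] is symmetric about [Q / 2], this reads
    [delta < delta_jump] ([strong_shock_jumps]).  Finally, as [U] decreases,
    [theta] increases exactly until [U = Q / 2], and the right end velocity is at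
    least [Q / 2] if and only if [delta <= delta_spike].  Otherwise [theta] first rises and
    then falls, with its peak where [U = Q / 2], or at the jump if that value is
    skipped ([temperature_peak]). *)

Ltac ring_R :=
  cbv beta;
  match goal with |- @eq _ ?x ?y => change (@eq R x y) end; ring.

(** * Smooth bumps *)

Definition flat (j : nat) (s : R) : R :=
  if Rlt_dec 0 s then (/ s) ^ j * exp (- / s) else 0.

Lemma flat_pos_eq j s : 0 < s -> flat j s = (/ s) ^ j * exp (- / s).
Proof. unfold flat; destruct (Rlt_dec 0 s); [reflexivity | lra]. Qed.

Lemma flat_npos_eq j s : s <= 0 -> flat j s = 0.
Proof. unfold flat; destruct (Rlt_dec 0 s); [lra | reflexivity]. Qed.

Lemma pow_le_exp (s : R) (k : nat) : 0 <= s -> s ^ k <= INR (fact k) * exp s.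
Proof.
  intros Hs.
  pose proof (exp_ge_taylor s k Hs) as H.
  assert (Hf : 0 < INR (fact k)) by apply INR_fact_lt_0.
  assert (H1 : s ^ k / INR (fact k) <= exp s).
  { eapply Rle_trans; [| exact H].
    destruct k as [|k]; [simpl; lra |].
    rewrite tech5.
    assert (0 <= sum_f_R0 (fun i => s ^ i / INR (fact i)) k).
    { apply cond_pos_sum. intros i. apply Rdiv_le_0_compat.
      apply pow_le; exact Hs. apply INR_fact_lt_0. }
    lra. }
  apply (Rmult_le_compat_l (INR (fact k))) in H1; [| lra].
  replace (INR (fact k) * (s ^ k / INR (fact k))) with (s ^ k) in H1
    by (field; lra).
  exact H1.
Qed.

(** The exponential beats every power, so [flat] vanishes to second order at
    the origin; that is what makes it differentiable there. *)
Lemma flat_quadratic (j : nat) (s : R) :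
  Rabs (flat j s) <= INR (fact (j + 2)) * s ^ 2.
Proof.
  assert (Hf : 0 < INR (fact (j + 2))) by apply INR_fact_lt_0.
  destruct (Rlt_dec 0 s) as [Hs | Hs].
  - rewrite flat_pos_eq by exact Hs.
    assert (Hi : 0 < / s) by (apply Rinv_0_lt_compat; exact Hs).
    rewrite Rabs_right.
    2:{ apply Rle_ge, Rmult_le_pos; [apply pow_le; lra | left; apply exp_pos]. }
    pose proof (pow_le_exp (/ s) (j + 2) (Rlt_le _ _ Hi)) as H.
    rewrite pow_add in H.
    rewrite exp_Ropp.
    assert (He : 0 < exp (/ s)) by apply exp_pos.
    apply (Rmult_le_compat_r (s ^ 2 * / exp (/ s))) in H.
    2:{ apply Rmult_le_pos; [nra | left; apply Rinv_0_lt_compat, He]. }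
    replace ((/ s) ^ j * / exp (/ s))
      with ((/ s) ^ j * (/ s) ^ 2 * (s ^ 2 * / exp (/ s))) by (field; lra).
    replace (INR (fact (j + 2)) * s ^ 2) with
      (INR (fact (j + 2)) * exp (/ s) * (s ^ 2 * / exp (/ s))) by (field; lra).
    exact H.
  - rewrite flat_npos_eq by lra. rewrite Rabs_R0. nra.
Qed.

Lemma is_derive_flat (j : nat) (s : R) :
  is_derive (flat j) s (flat (j + 2) s - INR j * flat (j + 1) s).
Proof.
  destruct (Rtotal_order s 0) as [Hs | [-> | Hs]].
  - rewrite !flat_npos_eq by lra.
    replace (0 - INR j * 0) with 0 by ring.
    apply is_derive_ext_loc with (f := fun _ => 0); [| auto_derive; auto].
    assert (He : 0 < - s) by lra.
    exists (mkposreal _ He). intros y Hy.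
    apply Rabs_def2 in Hy. simpl in Hy.
    unfold minus, plus, opp in Hy; simpl in Hy.
    rewrite flat_npos_eq; lra.
  - rewrite !flat_npos_eq by lra.
    replace (0 - INR j * 0) with 0 by ring.
    apply is_derive_Reals. intros eps Heps.
    assert (Hf : 0 < INR (fact (j + 2))) by apply INR_fact_lt_0.
    assert (Hd : 0 < eps / INR (fact (j + 2))) by (apply Rdiv_lt_0_compat; lra).
    exists (mkposreal _ Hd). intros h Hh Hhd. simpl in Hhd.
    rewrite (flat_npos_eq j 0) by lra. rewrite Rplus_0_l.
    replace ((flat j h - 0) / h - 0) with (flat j h / h) by (field; lra).
    unfold Rdiv. rewrite Rabs_mult, Rabs_inv.
    pose proof (flat_quadratic j h) as Hq.
    assert (Hah : 0 < Rabs h) by (apply Rabs_pos_lt; exact Hh).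
    apply Rle_lt_trans with (INR (fact (j + 2)) * Rabs h).
    + apply (Rmult_le_reg_r (Rabs h)); [exact Hah |].
      rewrite Rmult_assoc, Rinv_l by lra.
      rewrite <- pow2_abs in Hq. nra.
    + apply (Rmult_lt_compat_l (INR (fact (j + 2)))) in Hhd; [| lra].
      replace (INR (fact (j + 2)) * (eps / INR (fact (j + 2)))) with eps in Hhd
        by (field; lra).
      exact Hhd.
  - rewrite !flat_pos_eq by lra.
    apply is_derive_ext_loc with (f := fun t => (/ t) ^ j * exp (- / t)).
    + exists (mkposreal _ Hs). intros y Hy.
      apply Rabs_def2 in Hy. simpl in Hy.
      unfold minus, plus, opp in Hy; simpl in Hy.
      rewrite flat_pos_eq; lra.
    + auto_derive; [split; [| split]; auto; lra |].
      rewrite !pow_add.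
      destruct j as [|j]; [simpl; field; lra |].
      replace (pred (S j)) with j by reflexivity.
      change ((/ s) ^ S j) with (/ s * (/ s) ^ j).
      set (e := exp _). set (q := (/ s) ^ j). field; lra.
Qed.

(** The generators and operations are chosen so that the class is closed under
    differentiation, which makes every member infinitely differentiable; the
    last clause lets in antiderivatives, among them the test functions below. *)
Inductive bumpy : (R -> R) -> Prop :=
| bumpy_flat j a b : bumpy (fun t => flat j (a * t + b))
| bumpy_scal k f : bumpy f -> bumpy (fun t => k * f t)
| bumpy_plus f g : bumpy f -> bumpy g -> bumpy (fun t => f t + g t)
| bumpy_mult f g : bumpy f -> bumpy g -> bumpy (fun t => f t * g t)
| bumpy_prim F f : bumpy f -> (forall x, is_derive F x (f x)) -> bumpy F.

Lemma bumpy_derive f :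
  bumpy f -> exists g, bumpy g /\ forall x, is_derive f x (g x).
Proof.
  induction 1 as [j a b | k f Hf [g [Hg Hd]]
    | f1 f2 H1 [g1 [Hg1 Hd1]] H2 [g2 [Hg2 Hd2]]
    | f1 f2 H1 [g1 [Hg1 Hd1]] H2 [g2 [Hg2 Hd2]] | F f Hf _ HF].
  - exists (fun t => a * (flat (j + 2) (a * t + b)
              + (- INR j) * flat (j + 1) (a * t + b))).
    split.
    + apply bumpy_scal, bumpy_plus; [| apply bumpy_scal]; apply bumpy_flat.
    + intros x.
      evar_last.
      * apply is_derive_comp with (f := flat j) (g := fun t => a * t + b).
        -- apply is_derive_flat.
        -- auto_derive; [exact I | reflexivity].
      * unfold scal; simpl; unfold mult; simpl. ring.
  - exists (fun t => k * g t). split; [apply bumpy_scal, Hg |].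
    intros x. apply is_derive_scal, Hd.
  - exists (fun t => g1 t + g2 t). split; [apply bumpy_plus; assumption |].
    intros x. apply (is_derive_plus f1 f2 x (g1 x) (g2 x) (Hd1 x) (Hd2 x)).
  - exists (fun t => g1 t * f2 t + f1 t * g2 t). split.
    + apply bumpy_plus; apply bumpy_mult; assumption.
    + intros x.
      apply (is_derive_mult f1 f2 x (g1 x) (g2 x) (Hd1 x) (Hd2 x)).
      intros; apply Rmult_comm.
  - exists f. split; assumption.
Qed.

Lemma bumpy_smooth f : bumpy f -> forall (k : nat) (x : R), ex_derive_n f k x.
Proof.
  intros Hf.
  assert (H : forall k, exists g, bumpy g /\ forall x, Derive_n f k x = g x).
  { induction k as [|k [g [Hg Hk]]].
    - exists f. split; [exact Hf | reflexivity].
    - destruct (bumpy_derive g Hg) as [g' [Hg' Hd]].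
      exists g'. split; [exact Hg' |]. intros x. simpl.
      rewrite (Derive_ext _ g) by exact Hk.
      apply is_derive_unique, Hd. }
  intros [|k] x; [exact I |].
  destruct (H k) as [g [Hg Hk]].
  destruct (bumpy_derive g Hg) as [g' [_ Hd]].
  simpl. apply ex_derive_ext with g.
  - intros t. symmetry. apply Hk.
  - exists (g' x). apply Hd.
Qed.

Lemma bumpy_continuous f x : bumpy f -> continuous f x.
Proof.
  intros Hf. destruct (bumpy_derive f Hf) as [g [_ Hd]].
  apply (ex_derive_continuous f). exists (g x). apply Hd.
Qed.

Lemma bumpy_ex_RInt f a b : bumpy f -> ex_RInt f a b.
Proof.
  intros Hf. apply (ex_RInt_continuous f). intros z _.
  apply bumpy_continuous, Hf.
Qed.

Definition bump (a b t : R) : R := flat 0 (1 * t + - a) * flat 0 (- 1 * t + b).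

Lemma bumpy_bump a b : bumpy (bump a b).
Proof. apply bumpy_mult; apply bumpy_flat. Qed.

Lemma bump_pos a b t : a < t < b -> 0 < bump a b t.
Proof.
  intros Ht. unfold bump. rewrite !flat_pos_eq by lra.
  simpl. rewrite !Rmult_1_l. apply Rmult_lt_0_compat; apply exp_pos.
Qed.

Lemma bump_zero a b t : t <= a \/ b <= t -> bump a b t = 0.
Proof.
  intros [Ht | Ht]; unfold bump.
  - rewrite (flat_npos_eq 0 (1 * t + - a)) by lra. ring.
  - rewrite (flat_npos_eq 0 (- 1 * t + b)) by lra. ring.
Qed.

Lemma bump_nonneg a b t : 0 <= bump a b t.
Proof.
  destruct (Rle_dec t a); [rewrite bump_zero; auto; lra |].
  destruct (Rle_dec b t); [rewrite bump_zero; auto; lra |].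
  left. apply bump_pos. lra.
Qed.

Lemma bump_mass a b lo hi : lo <= a -> a < b -> b <= hi ->
  0 < RInt (bump a b) lo hi.
Proof.
  intros H1 H2 H3.
  assert (Hex : forall p q, ex_RInt (bump a b) p q)
    by (intros; apply bumpy_ex_RInt, bumpy_bump).
  rewrite <- (RInt_Chasles (bump a b) lo a hi) by apply Hex.
  rewrite <- (RInt_Chasles (bump a b) a b hi) by apply Hex.
  assert (0 <= RInt (bump a b) lo a)
    by (apply RInt_ge_0; auto; intros; apply bump_nonneg).
  assert (0 <= RInt (bump a b) b hi)
    by (apply RInt_ge_0; auto; intros; apply bump_nonneg).
  assert (0 < RInt (bump a b) a b).
  { apply RInt_gt_0; [exact H2 | apply bump_pos |].
    intros; apply bumpy_continuous, bumpy_bump. }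
  unfold plus; simpl. lra.
Qed.

(** * From weak to classical equations *)

Lemma continuous_eps (f : R -> R) (x : R) : continuous f x ->
  forall e, 0 < e -> exists d, 0 < d /\
    forall y, Rabs (y - x) < d -> Rabs (f y - f x) < e.
Proof.
  intros H e He.
  destruct (proj1 (filterlim_locally f (f x)) H (mkposreal e He)) as [d Hd].
  exists d. split; [apply cond_pos |]. intros y Hy. apply (Hd y Hy).
Qed.

(** A bump of one sign at [x], balanced by one of the other sign at [y], is the
    derivative of a test function; if [K x < K y] it gives the integral a
    sign. *)
Lemma du_bois_reymond_le (K : R -> R) (x y r : R) :
  x < y -> 0 < r -> continuous K x -> continuous K y ->
  (forall a b phi, x - r < a -> a < b -> b < y + r -> test_function a b phi ->
     is_RInt (fun t => K t * Derive phi t) a b 0) ->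
  K y <= K x.
Proof.
  intros Hxy Hr Hcx Hcy HK.
  destruct (Rle_dec (K y) (K x)) as [|Hlt]; [assumption | exfalso].
  apply Rnot_le_lt in Hlt.
  set (d := (K y - K x) / 4). set (k := (K x + K y) / 2).
  assert (Hd : 0 < d) by (unfold d; lra).
  destruct (continuous_eps K x Hcx d Hd) as [ex [Hex Hx]].
  destruct (continuous_eps K y Hcy d Hd) as [ey [Hey Hy]].
  set (e := Rmin (Rmin ex ey) (Rmin (r / 2) ((y - x) / 2))).
  assert (He : 0 < e /\ e <= ex /\ e <= ey /\ e <= r / 2 /\ e <= (y - x) / 2).
  { unfold e.
    pose proof (Rmin_l (Rmin ex ey) (Rmin (r / 2) ((y - x) / 2))).
    pose proof (Rmin_r (Rmin ex ey) (Rmin (r / 2) ((y - x) / 2))).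
    pose proof (Rmin_l ex ey). pose proof (Rmin_r ex ey).
    pose proof (Rmin_l (r / 2) ((y - x) / 2)).
    pose proof (Rmin_r (r / 2) ((y - x) / 2)).
    repeat split; try lra.
    repeat apply Rmin_pos; lra. }
  destruct He as [He [He1 [He2 [He3 He4]]]].
  set (a := x - e). set (b := y + e).
  set (Bx := bump (x - e) (x + e)). set (By := bump (y - e) (y + e)).
  set (Mx := RInt Bx a b). set (My := RInt By a b).
  assert (HMx : 0 < Mx) by (apply bump_mass; unfold a, b; lra).
  assert (HMy : 0 < My) by (apply bump_mass; unfold a, b; lra).
  set (f := fun t => My * Bx t + (- Mx) * By t).
  assert (Hf : bumpy f).
  { apply bumpy_plus; apply bumpy_scal; apply bumpy_bump. }
  set (phi := RInt f a).
  assert (Hphi : forall t, is_derive phi t (f t)).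
  { intros t. apply (is_derive_RInt f phi a).
    - apply filter_forall. intros s. apply (RInt_correct f), bumpy_ex_RInt, Hf.
    - apply bumpy_continuous, Hf. }
  assert (IBx : is_RInt Bx a b Mx)
    by apply (RInt_correct Bx), bumpy_ex_RInt, bumpy_bump.
  assert (IBy : is_RInt By a b My)
    by apply (RInt_correct By), bumpy_ex_RInt, bumpy_bump.
  assert (If : is_RInt f a b 0).
  { evar_last. apply (is_RInt_plus (V := R_NormedModule)).
    - apply (is_RInt_scal (V := R_NormedModule)), IBx.
    - apply (is_RInt_scal (V := R_NormedModule)), IBy.
    - unfold plus, scal; simpl; unfold mult; simpl. ring. }
  assert (Htest : test_function a b phi).
  { split.
    - apply bumpy_smooth. apply (bumpy_prim phi f Hf Hphi).
    - assert (Hz : forall p q, (p <= a /\ q <= a) \/ (b <= p /\ b <= q) ->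
        RInt f p q = 0).
      { intros p q Hpq. rewrite (RInt_ext f (fun _ => 0)).
        - rewrite RInt_const. unfold scal; simpl; unfold mult; simpl. ring.
        - intros t Ht. change (@eq R (f t) 0). unfold f, Bx, By.
          assert (Hm : t <= a \/ b <= t).
          { destruct Hpq as [Hpq | Hpq]; [left | right].
            - apply Rle_trans with (Rmax p q); [lra | apply Rmax_lub; lra].
            - apply Rle_trans with (Rmin p q); [apply Rmin_glb; lra | lra]. }
          unfold a, b in Hm. rewrite !bump_zero by lra. ring. }
      intros t [Ht | Ht]; unfold phi.
      + apply Hz. lra.
      + rewrite <- (RInt_Chasles f a b t) by apply bumpy_ex_RInt, Hf.
        rewrite (is_RInt_unique _ _ _ _ If).
        rewrite (Hz b t) by lra. unfold plus; simpl; lra. }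
  assert (Hab : a < b) by (unfold a, b; lra).
  assert (I1 : is_RInt (fun t => K t * f t) a b 0).
  { apply is_RInt_ext with (fun t => K t * Derive phi t).
    - intros t _. rewrite (is_derive_unique phi t (f t) (Hphi t)). reflexivity.
    - apply HK; auto; unfold a, b; lra. }
  assert (I2 : is_RInt (fun t => (k - K t) * f t) a b 0).
  { evar_last.
    - apply is_RInt_ext with (fun t => minus (scal k (f t)) (K t * f t)).
      + intros t _. unfold minus, plus, opp, scal; simpl.
        unfold mult; simpl. ring.
      + apply (is_RInt_minus (V := R_NormedModule)).
        * apply (is_RInt_scal (V := R_NormedModule)), If.
        * exact I1.
    - unfold minus, plus, opp, scal; simpl; unfold mult; simpl. ring. }
  assert (I3 : is_RInt (fun t => d * (My * Bx t + Mx * By t)) a b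
                 (d * (My * Mx + Mx * My))).
  { evar_last.
    - apply (is_RInt_scal (V := R_NormedModule)),
        (is_RInt_plus (V := R_NormedModule)).
      + apply (is_RInt_scal (V := R_NormedModule)), IBx.
      + apply (is_RInt_scal (V := R_NormedModule)), IBy.
    - reflexivity. }
  assert (Hle : d * (My * Mx + Mx * My) <= 0).
  { apply (is_RInt_le _ _ a b _ _ (Rlt_le _ _ Hab) I3 I2).
    intros t Ht. unfold f.
    pose proof (bump_nonneg (x - e) (x + e) t) as Px. fold Bx in Px.
    pose proof (bump_nonneg (y - e) (y + e) t) as Py. fold By in Py.
    assert (Q1 : d * Bx t <= (k - K t) * Bx t).
    { destruct (Rlt_dec (Rabs (t - x)) e) as [Hc | Hc].
      - assert (Hc' : Rabs (t - x) < ex) by lra.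
        specialize (Hx t Hc'). apply Rabs_def2 in Hx.
        apply Rmult_le_compat_r; [exact Px |]. unfold k, d in *; lra.
      - unfold Bx. rewrite bump_zero; [lra |].
        destruct (Rle_dec t (x - e)); [auto | right].
        apply Rnot_lt_le. intros Hc2. apply Hc. apply Rabs_def1; lra. }
    assert (Q2 : d * By t <= (K t - k) * By t).
    { destruct (Rlt_dec (Rabs (t - y)) e) as [Hc | Hc].
      - assert (Hc' : Rabs (t - y) < ey) by lra.
        specialize (Hy t Hc'). apply Rabs_def2 in Hy.
        apply Rmult_le_compat_r; [exact Py |]. unfold k, d in *; lra.
      - unfold By. rewrite bump_zero; [lra |].
        destruct (Rle_dec t (y - e)); [auto | right].
        apply Rnot_lt_le. intros Hc2. apply Hc. apply Rabs_def1; lra. }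
    apply (Rmult_le_compat_l My) in Q1; [| lra].
    apply (Rmult_le_compat_l Mx) in Q2; [| lra].
    nra. }
  assert (0 < Mx * My) by (apply Rmult_lt_0_compat; assumption).
  nra.
Qed.

Lemma du_bois_reymond (K : R -> R) (x y r : R) :
  x < y -> 0 < r -> continuous K x -> continuous K y ->
  (forall a b phi, x - r < a -> a < b -> b < y + r -> test_function a b phi ->
     is_RInt (fun t => K t * Derive phi t) a b 0) ->
  K x = K y.
Proof.
  intros Hxy Hr Hcx Hcy HK. apply Rle_antisym.
  - apply Ropp_le_cancel.
    apply (du_bois_reymond_le (fun t => - K t) x y r); auto.
    + apply (continuous_opp K x Hcx).
    + apply (continuous_opp K y Hcy).
    + intros a b phi Ha Hab Hb Hphi.
      evar_last.
      * apply is_RInt_ext with (fun t => opp (K t * Derive phi t)).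
        -- intros t _. unfold opp; simpl. ring.
        -- apply (is_RInt_opp (V := R_NormedModule)).
           apply (HK a b phi Ha Hab Hb Hphi).
      * unfold opp; simpl. ring.
  - apply (du_bois_reymond_le K x y r); auto.
Qed.

Lemma weak_constant (F : R -> R) (x y : R) :
  weak_derivative F (fun _ => 0) -> continuous F x -> continuous F y ->
  F x = F y.
Proof.
  intros HF.
  assert (Hlt : forall p q, p < q -> continuous F p -> continuous F q ->
            F p = F q).
  { intros p q Hpq Hp Hq. apply (du_bois_reymond F p q 1); auto; try lra.
    intros a b phi _ Hab _ Hphi.
    apply is_RInt_ext with (fun t => F t * Derive phi t + 0 * phi t).
    - intros t _. ring_R.
    - apply (HF a b phi Hab Hphi). }
  intros Hx Hy. destruct (Rtotal_order x y) as [H | [-> | H]]; auto.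
  symmetry; auto.
Qed.

Lemma test_function_ends a b phi :
  test_function a b phi -> a < b -> phi a = 0 /\ phi b = 0.
Proof.
  intros [Hs Hz] Hab.
  assert (Hc : forall x, continuous phi x).
  { intros x. apply (ex_derive_continuous phi). apply (Hs 1%nat x). }
  split; apply NNPP; intros Hne.
  - destruct (continuous_eps phi a (Hc a) _ (Rabs_pos_lt _ Hne)) as [d [Hd H]].
    specialize (H (a - d / 2)).
    rewrite (Hz (a - d / 2)) in H by lra.
    assert (Ha : Rabs (a - d / 2 - a) < d) by (apply Rabs_def1; lra).
    specialize (H Ha). rewrite Rminus_0_l, Rabs_Ropp in H. lra.
  - destruct (continuous_eps phi b (Hc b) _ (Rabs_pos_lt _ Hne)) as [d [Hd H]].
    specialize (H (b + d / 2)).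
    rewrite (Hz (b + d / 2)) in H by lra.
    assert (Ha : Rabs (b + d / 2 - b) < d) by (apply Rabs_def1; lra).
    specialize (H Ha). rewrite Rminus_0_l, Rabs_Ropp in H. lra.
Qed.

(** Subtracting an antiderivative of [G] turns the equation into [K' = 0]. *)
Lemma weak_derivative_classical (F G : R -> R) (x r : R) :
  weak_derivative F G -> 0 < r ->
  (forall t, Rabs (t - x) < r -> continuous F t /\ continuous G t) ->
  is_derive F x (G x).
Proof.
  intros HF Hr Hc.
  set (H := RInt G x).
  assert (HG : forall t, Rabs (t - x) < r -> is_RInt G x t (H t)).
  { intros t Ht. apply (RInt_correct G), (ex_RInt_continuous G).
    intros z Hz. apply Hc. apply Rabs_def2 in Ht. apply Rabs_def1.
    - apply Rle_lt_trans with (Rmax x t - x); [lra |].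
      unfold Rmax; destruct (Rle_dec x t); lra.
    - apply Rlt_le_trans with (Rmin x t - x); [| lra].
      unfold Rmin; destruct (Rle_dec x t); lra. }
  assert (HH : forall t, Rabs (t - x) < r -> is_derive H t (G t)).
  { intros t Ht. apply (is_derive_RInt G H x); [| apply Hc, Ht].
    assert (Hp : 0 < r - Rabs (t - x)) by lra.
    exists (mkposreal _ Hp). intros s Hs. apply HG.
    change (Rabs (s - t) < r - Rabs (t - x)) in Hs.
    replace (s - x) with ((s - t) + (t - x)) by ring.
    eapply Rle_lt_trans; [apply Rabs_triang | lra]. }
  set (K := fun t => F t - H t).
  assert (HKc : forall t, Rabs (t - x) < r -> continuous K t).
  { intros t Ht. apply (continuous_minus F H).
    - apply Hc, Ht.
    - apply (ex_derive_continuous H). exists (G t). apply HH, Ht. }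
  assert (HK : forall p q, p < q -> Rabs (p - x) < r -> Rabs (q - x) < r ->
            K p = K q).
  { intros p q Hpq Hp Hq.
    apply Rabs_def2 in Hp as Hp'. apply Rabs_def2 in Hq as Hq'.
    assert (Hr' : 0 < Rmin (r - (x - p)) (r - (q - x))) by (apply Rmin_pos; lra).
    apply (du_bois_reymond K p q _ Hpq Hr'); auto.
    intros a b phi Ha Hab Hb Hphi.
    pose proof (Rmin_l (r - (x - p)) (r - (q - x))).
    pose proof (Rmin_r (r - (x - p)) (r - (q - x))).
    assert (Hin : forall t, a <= t <= b -> Rabs (t - x) < r)
      by (intros t Ht; apply Rabs_def1; lra).
    destruct (test_function_ends a b phi Hphi Hab) as [Ea Eb].
    assert (Hd : forall t, is_derive phi t (Derive phi t)).
    { intros t. apply Derive_correct, (proj1 Hphi 1%nat t). }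
    assert (Hd2 : forall t, continuous (Derive phi) t).
    { intros t. apply (ex_derive_continuous (Derive phi)).
      apply (proj1 Hphi 2%nat t). }
    assert (Hc1 : forall t, continuous phi t).
    { intros t. apply (ex_derive_continuous phi). exists (Derive phi t). apply Hd. }
    assert (I1 : is_RInt (fun t => H t * Derive phi t + G t * phi t) a b 0).
    { evar_last.
      - apply (is_RInt_derive (fun t => H t * phi t)).
        + intros t Ht. rewrite Rmin_left, Rmax_right in Ht by lra.
          replace (H t * Derive phi t + G t * phi t) with
            (plus (mult (G t) (phi t)) (mult (H t) (Derive phi t)))
            by (unfold plus, mult; simpl; ring).
          apply (is_derive_mult H phi); auto.
          intros; apply Rmult_comm.
        + intros t Ht. rewrite Rmin_left, Rmax_right in Ht by lra.
          specialize (Hin t Ht).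
          apply (continuous_plus (fun t => H t * Derive phi t)
                   (fun t => G t * phi t)).
          * apply (continuous_mult H (Derive phi)); auto.
            apply (ex_derive_continuous H). exists (G t). apply HH, Hin.
          * apply (continuous_mult G phi); auto. apply Hc, Hin.
      - unfold minus, plus, opp; simpl. rewrite Ea, Eb. ring. }
    pose proof (HF a b phi Hab Hphi) as I2.
    pose proof (is_RInt_minus (V := R_NormedModule) _ _ _ _ _ _ I2 I1) as I3.
    evar_last.
    - eapply is_RInt_ext; [| exact I3].
      intros t _. unfold K, minus, plus, opp; simpl. ring.
    - unfold minus, plus, opp; simpl. ring. }
  apply is_derive_ext_loc with (f := fun t => plus (F x) (H t)).
  - exists (mkposreal _ Hr). intros t Ht. change (Rabs (t - x) < r) in Ht.
    assert (H0 : H x = 0) by apply (RInt_point (V := R_CompleteNormedModule)).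
    assert (Hx0 : Rabs (x - x) < r) by (rewrite Rminus_diag, Rabs_R0; exact Hr).
    assert (E : K x = K t).
    { destruct (Rtotal_order x t) as [L | [-> | L]]; auto.
      symmetry; auto. }
    unfold K in E. unfold plus; simpl. lra.
  - replace (G x) with (plus 0 (G x)) by (unfold plus; simpl; ring).
    apply (is_derive_plus (fun _ => F x) H).
    + apply (is_derive_const (F x)).
    + apply HH. rewrite Rminus_diag, Rabs_R0; exact Hr.
Qed.

(** * Real-variable tools *)

Lemma locally_free (J : list R) (z : R) :
  exists d, 0 < d /\ forall x, Rabs (x - z) < d -> x <> z -> ~ In x J.
Proof.
  induction J as [|a J [d [Hd H]]].
  - exists 1. split; [lra | intros; intros []].
  - destruct (Req_dec a z) as [-> | Ha].
    + exists d. split; [exact Hd |]. intros x Hx Hz [E | Hin]; [auto |].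
      apply (H x Hx Hz Hin).
    + assert (Hp : 0 < Rabs (a - z)) by (apply Rabs_pos_lt; lra).
      exists (Rmin d (Rabs (a - z))). split; [apply Rmin_pos; assumption |].
      intros x Hx Hz [E | Hin].
      * subst x. pose proof (Rmin_r d (Rabs (a - z))). lra.
      * pose proof (Rmin_l d (Rabs (a - z))). apply (H x); auto; lra.
Qed.

Lemma list_bounded (J : list R) : exists B, forall x, In x J -> - B < x < B.
Proof.
  induction J as [|a J [B H]].
  - exists 0. intros x [].
  - exists (Rmax B (Rabs a + 1)). intros x [<- | Hx].
    + pose proof (Rmax_r B (Rabs a + 1)). pose proof (Rle_abs a).
      pose proof (Rle_abs (- a)). rewrite Rabs_Ropp in *. lra.
    + specialize (H x Hx). pose proof (Rmax_l B (Rabs a + 1)). lra.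
Qed.

Lemma continuous_continuity_pt (f : R -> R) (x : R) :
  continuous f x -> continuity_pt f x.
Proof. intros H. apply continuity_pt_filterlim, H. Qed.

Lemma mvt (f df : R -> R) (a b : R) : a < b ->
  (forall x, a < x < b -> is_derive f x (df x)) ->
  (forall x, a <= x <= b -> continuous f x) ->
  exists c, a < c < b /\ f b - f a = df c * (b - a).
Proof.
  intros Hab Hd Hc.
  assert (pr : forall c, a < c < b -> derivable_pt f c).
  { intros c H. exists (df c). apply is_derive_Reals, Hd, H. }
  assert (pi : forall c, a < c < b -> derivable_pt id c)
    by (intros; apply derivable_pt_id).
  destruct (MVT f id a b pr pi Hab) as [c [P E]].
  - intros c H. apply continuous_continuity_pt, Hc, H.
  - intros c _. apply derivable_continuous_pt, derivable_pt_id.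
  - exists c. split; [exact P |].
    rewrite (derive_pt_eq_0 id c 1 (pi c P) (derivable_pt_lim_id c)) in E.
    rewrite (derive_pt_eq_0 f c (df c) (pr c P)) in E
      by apply is_derive_Reals, Hd, P.
    unfold id in E. lra.
Qed.

Lemma derive_local_max (f : R -> R) (z l d : R) : 0 < d -> is_derive f z l ->
  (forall x, Rabs (x - z) < d -> f x <= f z) -> l = 0.
Proof.
  intros Hd Hl H.
  assert (pr : derivable_pt f z) by (exists l; apply is_derive_Reals, Hl).
  rewrite <- (derive_pt_eq_0 f z l pr) by apply is_derive_Reals, Hl.
  apply (deriv_maximum f (z - d) (z + d)); try lra.
  intros x H1 H2. apply H. apply Rabs_def1; lra.
Qed.

Lemma derive_local_min (f : R -> R) (z l d : R) : 0 < d -> is_derive f z l ->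
  (forall x, Rabs (x - z) < d -> f z <= f x) -> l = 0.
Proof.
  intros Hd Hl H.
  enough (- l = 0) by lra.
  apply (derive_local_max (fun x => - f x) z (- l) d Hd).
  - apply (is_derive_opp f z l Hl).
  - intros x Hx. specialize (H x Hx). lra.
Qed.

Lemma is_derive_eps (f : R -> R) (z l : R) : is_derive f z l ->
  forall e, 0 < e -> exists d, 0 < d /\ forall x, Rabs (x - z) < d ->
    Rabs (f x - f z - l * (x - z)) <= e * Rabs (x - z).
Proof.
  intros H e He. apply is_derive_Reals in H.
  destruct (H e He) as [d Hd]. exists d. split; [apply cond_pos |].
  intros x Hx. destruct (Req_dec x z) as [-> | Hne].
  - rewrite !Rminus_diag, Rmult_0_r, Rminus_diag, Rabs_R0. lra.
  - specialize (Hd (x - z)).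
    replace (z + (x - z)) with x in Hd by ring.
    assert (Hn : x - z <> 0) by lra.
    specialize (Hd Hn Hx).
    replace (f x - f z - l * (x - z))
      with (((f x - f z) / (x - z) - l) * (x - z)) by (field; exact Hn).
    rewrite Rabs_mult. apply Rmult_le_compat_r; [apply Rabs_pos | lra].
Qed.

Lemma ivt (f : R -> R) (a b : R) : a < b ->
  (forall x, a <= x <= b -> continuous f x) -> f a * f b < 0 ->
  exists z, a < z < b /\ f z = 0.
Proof.
  intros Hab Hc Hs.
  assert (Ha : f a <> 0) by (intros E; rewrite E in Hs; lra).
  assert (Hb : f b <> 0) by (intros E; rewrite E in Hs; lra).
  assert (Hz : exists z, a <= z <= b /\ f z = 0).
  { destruct (Rlt_dec (f a) 0) as [L | L].
    - destruct (Ranalysis5.IVT_interv f a b) as [z Hz]; auto.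
      + intros x Hx. apply continuous_continuity_pt, Hc, Hx.
      + nra.
      + exists z; exact Hz.
    - destruct (Ranalysis5.IVT_interv (fun x => - f x) a b) as [z [Hz E]]; auto.
      + intros x Hx. apply (continuous_continuity_pt (fun x => - f x)).
        apply (continuous_opp f x), Hc, Hx.
      + lra.
      + nra.
      + exists z. split; [exact Hz | lra]. }
  destruct Hz as [z [Hz E]]. exists z. split; [| exact E].
  assert (z <> a) by (intros ->; auto). assert (z <> b) by (intros ->; auto). lra.
Qed.

Lemma left_lim_eps (f : R -> R) (x l : R) : left_lim f x l ->
  forall e, 0 < e -> exists d, 0 < d /\
    forall y, x - d < y < x -> Rabs (f y - l) < e.
Proof.
  intros H e He.
  destruct (proj1 (filterlim_locally f l) H (mkposreal e He)) as [d Hd].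
  exists d. split; [apply cond_pos |]. intros y Hy.
  apply (Hd y); [| lra]. change (Rabs (y - x) < d). apply Rabs_def1; lra.
Qed.

Lemma right_lim_eps (f : R -> R) (x l : R) : right_lim f x l ->
  forall e, 0 < e -> exists d, 0 < d /\
    forall y, x < y < x + d -> Rabs (f y - l) < e.
Proof.
  intros H e He.
  destruct (proj1 (filterlim_locally f l) H (mkposreal e He)) as [d Hd].
  exists d. split; [apply cond_pos |]. intros y Hy.
  apply (Hd y); [| lra]. change (Rabs (y - x) < d). apply Rabs_def1; lra.
Qed.

Lemma is_lim_m_eps (f : R -> R) (l : R) : is_lim f m_infty l ->
  forall e, 0 < e -> exists B, forall y, y < B -> Rabs (f y - l) < e.
Proof.
  intros H e He. apply is_lim_spec in H.
  destruct (H (mkposreal e He)) as [B HB]. exists B. exact HB.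
Qed.

Lemma is_lim_p_eps (f : R -> R) (l : R) : is_lim f p_infty l ->
  forall e, 0 < e -> exists B, forall y, B < y -> Rabs (f y - l) < e.
Proof.
  intros H e He. apply is_lim_spec in H.
  destruct (H (mkposreal e He)) as [B HB]. exists B. exact HB.
Qed.

(** * The reduced dynamics *)

(** Here [v = U - U_c], [w = n'] and [G = g(theta)]; [v > 0] is the supersonic
    side, [v < 0] the subsonic one.  [G_lip] encodes that [G] is a smooth
    function of [v], hence of [w] away from the sonic value. *)
Record reduced (A h k gc : R) (J : list R) (v w n G : R -> R) : Prop := {
  A_pos : 0 < A;
  h_pos : 0 < h;
  k_pos : 0 < k;
  n_derive : forall x, is_derive n x (w x);
  w_cont : forall x, continuous w x;
  v_cont : forall x, ~ In x J -> continuous v x;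
  w_eq : forall x, ~ In x J -> w x = A * (h ^ 2 - v x ^ 2);
  w_derive : forall x, ~ In x J -> is_derive w x (k * (n x - G x));
  G_lip : forall z, ~ In z J -> v z <> 0 -> exists L d, 0 < L /\ 0 < d /\
    forall x, Rabs (x - z) < d -> Rabs (G x - G z) <= L * Rabs (w x - w z);
  G_sonic : forall x, ~ In x J -> v x = 0 -> G x = gc;
  G_super : forall x, ~ In x J -> 0 < v x -> G x < gc;
  G_sub : exists s, 0 < s /\
    forall x, ~ In x J -> - s < v x < 0 -> gc < G x;
  jump_sign : forall z, In z J -> exists s, 0 < s /\
    left_lim v z s /\ right_lim v z (- s);
  jump_heats : forall z, In z J -> exists q1 q2 d, q1 < q2 /\ 0 < d /\
    (forall x, z - d < x < z -> G x <= q1) /\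
    (forall x, z < x < z + d -> q2 <= G x);
  super_m : exists B, forall x, x < B -> 0 < v x;
  sub_p : exists B, forall x, B < x -> v x < 0;
  w_lim_m : is_lim w m_infty 0;
  w_lim_p : is_lim w p_infty 0 }.

Arguments A_pos {A h k gc J v w n G}.
Arguments h_pos {A h k gc J v w n G}.
Arguments k_pos {A h k gc J v w n G}.
Arguments n_derive {A h k gc J v w n G}.
Arguments w_cont {A h k gc J v w n G}.
Arguments v_cont {A h k gc J v w n G}.
Arguments w_eq {A h k gc J v w n G}.
Arguments w_derive {A h k gc J v w n G}.
Arguments G_lip {A h k gc J v w n G}.
Arguments G_sonic {A h k gc J v w n G}.
Arguments G_super {A h k gc J v w n G}.
Arguments G_sub {A h k gc J v w n G}.
Arguments jump_sign {A h k gc J v w n G}.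
Arguments jump_heats {A h k gc J v w n G}.
Arguments super_m {A h k gc J v w n G}.
Arguments sub_p {A h k gc J v w n G}.
Arguments w_lim_m {A h k gc J v w n G}.
Arguments w_lim_p {A h k gc J v w n G}.

Lemma n_cont {A h k gc J v w n G} x :
  reduced A h k gc J v w n G -> continuous n x.
Proof.
  intros D. apply (ex_derive_continuous n). exists (w x). apply D.
Qed.

Lemma w_le_max {A h k gc J v w n G} x :
  reduced A h k gc J v w n G -> ~ In x J -> w x <= A * h ^ 2.
Proof.
  intros D Hx. rewrite (w_eq D x Hx).
  pose proof (A_pos D). nra.
Qed.

(** Where [w' = k (n - G)] vanishes, [G] is stationary by [G_lip], so formally
    [w'' = k n' = k w] and [w] moves away from zero.  Finite differences replace
    [w''] because [G] is only known to be Lipschitz. *)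
Lemma critical_escape {A h k gc J v w n G} z d :
  reduced A h k gc J v w n G -> ~ In z J -> v z <> 0 -> n z = G z ->
  w z <> 0 -> 0 < d ->
  exists x, z < x < z + d /\ 0 < (w x - w z) * w z.
Proof.
  intros D Hz Hv HG Hw Hd.
  destruct (G_lip D z Hz Hv) as [L [d1 [HL [Hd1 H1]]]].
  destruct (locally_free J z) as [d2 [Hd2 H2]].
  assert (Hc : 0 < Rabs (w z)) by (apply Rabs_pos_lt; exact Hw).
  set (c := Rabs (w z)) in *.
  destruct (continuous_eps w z (w_cont D z) (c / 2))
    as [d3 [Hd3 H3]]; [lra |].
  pose proof (w_derive D z Hz) as Hdw.
  assert (He : 0 < c / (4 * L)) by (apply Rdiv_lt_0_compat; lra).
  destruct (is_derive_eps w z _ Hdw _ He) as [d4 [Hd4 H4]].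
  set (r := Rmin (Rmin d d1) (Rmin d2 (Rmin d3 d4))).
  assert (Hr : 0 < r /\ r <= d /\ r <= d1 /\ r <= d2 /\ r <= d3 /\ r <= d4).
  { unfold r.
    pose proof (Rmin_l (Rmin d d1) (Rmin d2 (Rmin d3 d4))).
    pose proof (Rmin_r (Rmin d d1) (Rmin d2 (Rmin d3 d4))).
    pose proof (Rmin_l d d1). pose proof (Rmin_r d d1).
    pose proof (Rmin_l d2 (Rmin d3 d4)). pose proof (Rmin_r d2 (Rmin d3 d4)).
    pose proof (Rmin_l d3 d4). pose proof (Rmin_r d3 d4).
    repeat split; try lra. repeat apply Rmin_pos; lra. }
  destruct Hr as [Hr [Hrd [Hr1 [Hr2 [Hr3 Hr4]]]]].
  exists (z + r / 2). split; [lra |].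
  destruct (mvt w (fun t => k * (n t - G t)) z (z + r / 2)) as [y [Hy Ey]].
  - lra.
  - intros t Ht. apply D. apply H2; [apply Rabs_def1; lra | lra].
  - intros t Ht. apply D.
  - rewrite Ey.
    destruct (mvt n w z y) as [q [Hq Eq]].
    + lra.
    + intros t _. apply D.
    + intros t _. apply (n_cont _ D).
    + assert (Hyz : Rabs (y - z) = y - z) by (apply Rabs_right; lra).
      specialize (H4 y). rewrite Hyz in H4.
      assert (H4' := H4 ltac:(lra)). clear H4.
      replace (k * (n z - G z)) with 0 in H4' by (rewrite HG; ring).
      rewrite Rmult_0_l, Rminus_0_r in H4'.
      specialize (H1 y). rewrite Hyz in H1.
      assert (H1' := H1 ltac:(lra)). clear H1.
      assert (HGd : Rabs (G y - G z) <= c / 4 * (y - z)).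
      { apply Rle_trans with (L * (c / (4 * L) * (y - z))).
        - eapply Rle_trans; [exact H1' |].
          apply Rmult_le_compat_l; [lra | exact H4'].
        - right. field. lra. }
      assert (Hqz : Rabs (q - z) < d3) by (apply Rabs_def1; lra).
      specialize (H3 q Hqz).
      replace (n y - G y) with ((n y - n z) - (G y - G z)) by lra.
      rewrite Eq.
      assert (Hc2 : c * c = w z * w z).
      { unfold c. rewrite <- Rabs_mult. apply Rabs_right. nra. }
      assert (P1 : c * c / 2 <= w q * w z).
      { replace (w q * w z) with (c * c + (w q - w z) * w z) by (rewrite Hc2; ring).
        assert (Rabs ((w q - w z) * w z) <= c / 2 * c).
        { rewrite Rabs_mult. fold c. apply Rmult_le_compat_r; lra. }
        pose proof (Rle_abs (- ((w q - w z) * w z))). rewrite Rabs_Ropp in *. lra. }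
      assert (P2 : (G y - G z) * w z <= c * c / 4 * (y - z)).
      { eapply Rle_trans; [apply Rle_abs |]. rewrite Rabs_mult. fold c.
        apply Rle_trans with (c / 4 * (y - z) * c); [| lra].
        apply Rmult_le_compat_r; lra. }
      pose proof (k_pos D) as Hk.
      replace (k * (w q * (y - z) - (G y - G z)) * (z + r / 2 - z) * w z)
        with ((k * (r / 2)) * (w q * w z * (y - z) - (G y - G z) * w z)) by ring.
      apply Rmult_lt_0_compat; [apply Rmult_lt_0_compat; lra |].
      assert (c * c / 2 * (y - z) <= w q * w z * (y - z))
        by (apply Rmult_le_compat_r; lra).
      assert (0 < c * c * (y - z)) by (repeat apply Rmult_lt_0_compat; lra).
      lra.
Qed.

(** Across a jump the gas is heated, so [w' = k (n - G)] drops: a corner of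
    this kind is never a minimum. *)
Lemma jump_not_min {A h k gc J v w n G} z d :
  reduced A h k gc J v w n G -> In z J -> 0 < d ->
  ~ (forall x, Rabs (x - z) < d -> w z <= w x).
Proof.
  intros D Hz Hd Hmin.
  destruct (jump_heats D z Hz)
    as [q1 [q2 [d1 [Hq [Hd1 [Hl Hr]]]]]].
  destruct (locally_free J z) as [d2 [Hd2 H2]].
  destruct (continuous_eps n z (n_cont z D) ((q2 - q1) / 2))
    as [d3 [Hd3 H3]]; [lra |].
  pose proof (k_pos D) as Hk.
  set (r := Rmin (Rmin d d1) (Rmin d2 d3)).
  assert (Hrr : 0 < r /\ r <= d /\ r <= d1 /\ r <= d2 /\ r <= d3).
  { unfold r.
    pose proof (Rmin_l (Rmin d d1) (Rmin d2 d3)).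
    pose proof (Rmin_r (Rmin d d1) (Rmin d2 d3)).
    pose proof (Rmin_l d d1). pose proof (Rmin_r d d1).
    pose proof (Rmin_l d2 d3). pose proof (Rmin_r d2 d3).
    repeat split; try lra. repeat apply Rmin_pos; lra. }
  assert (N1 : exists y, z - r < y < z /\ n y <= q1).
  { destruct (mvt w (fun t => k * (n t - G t)) (z - r / 2) z) as [y [Hy Ey]].
    - lra.
    - intros t Ht. apply D. apply H2; [apply Rabs_def1; lra | lra].
    - intros t _. apply D.
    - exists y. split; [lra |].
      assert (Hm : w z <= w (z - r / 2)) by (apply Hmin, Rabs_def1; lra).
      assert (HG : G y <= q1) by (apply Hl; lra).
      assert (Hs : k * (n y - G y) <= 0).
      { apply Rnot_lt_le. intros P.
        assert (0 < k * (n y - G y) * (z - (z - r / 2)))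
          by (apply Rmult_lt_0_compat; lra). lra. }
      apply Rnot_lt_le. intros P.
      assert (0 < k * (n y - G y)) by (apply Rmult_lt_0_compat; lra). lra. }
  assert (N2 : exists y, z < y < z + r /\ q2 <= n y).
  { destruct (mvt w (fun t => k * (n t - G t)) z (z + r / 2)) as [y [Hy Ey]].
    - lra.
    - intros t Ht. apply D. apply H2; [apply Rabs_def1; lra | lra].
    - intros t _. apply D.
    - exists y. split; [lra |].
      assert (Hm : w z <= w (z + r / 2)) by (apply Hmin, Rabs_def1; lra).
      assert (HG : q2 <= G y) by (apply Hr; lra).
      apply Rnot_lt_le. intros P.
      assert (0 < k * (G y - n y)) by (apply Rmult_lt_0_compat; lra).
      assert (0 < k * (G y - n y) * (z + r / 2 - z))
        by (apply Rmult_lt_0_compat; lra).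
      lra. }
  destruct N1 as [y1 [Hy1 E1]]. destruct N2 as [y2 [Hy2 E2]].
  assert (T1 : Rabs (y1 - z) < d3) by (apply Rabs_def1; lra).
  assert (T2 : Rabs (y2 - z) < d3) by (apply Rabs_def1; lra).
  apply H3 in T1. apply H3 in T2.
  apply Rabs_def2 in T1. apply Rabs_def2 in T2. lra.
Qed.

Lemma attains_max (f : R -> R) (a b c : R) : a < c < b ->
  (forall x, continuous f x) -> f a < f c -> f b < f c ->
  exists z, a < z < b /\ f c <= f z /\ forall x, a <= x <= b -> f x <= f z.
Proof.
  intros Hc Hf Ha Hb.
  destruct (continuity_ab_maj f a b) as [z [Hz Hz']]; [lra | |].
  - intros x _. apply continuous_continuity_pt, Hf.
  - exists z. assert (Hcz : f c <= f z) by (apply Hz; lra).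
    split; [| split; assumption].
    assert (z <> a) by (intros ->; lra). assert (z <> b) by (intros ->; lra). lra.
Qed.

(** A negative minimum of [w] is neither a jump nor a sonic point, and at a
    regular one [w'' = k w < 0]. *)
Lemma w_nonneg {A h k gc J v w n G} x :
  reduced A h k gc J v w n G -> 0 <= w x.
Proof.
  intros D. apply Rnot_lt_le. intros Hneg.
  destruct (is_lim_m_eps w 0 (w_lim_m D) (- w x))
    as [B1 HB1]; [lra |].
  destruct (is_lim_p_eps w 0 (w_lim_p D) (- w x))
    as [B2 HB2]; [lra |].
  set (a := Rmin x B1 - 1). set (b := Rmax x B2 + 1).
  pose proof (Rmin_l x B1). pose proof (Rmin_r x B1).
  pose proof (Rmax_l x B2). pose proof (Rmax_r x B2).
  assert (Ha : Rabs (w a - 0) < - w x) by (apply HB1; unfold a; lra).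
  assert (Hb : Rabs (w b - 0) < - w x) by (apply HB2; unfold b; lra).
  apply Rabs_def2 in Ha. apply Rabs_def2 in Hb.
  destruct (attains_max (fun t => - w t) a b x) as [z [Hz [Hxz Hmax]]].
  - unfold a, b; lra.
  - intros t. apply (continuous_opp w t), D.
  - lra.
  - lra.
  - set (d := Rmin (z - a) (b - z)).
    pose proof (Rmin_l (z - a) (b - z)). pose proof (Rmin_r (z - a) (b - z)).
    assert (Hd : 0 < d) by (apply Rmin_pos; lra).
    assert (Hmin : forall t, Rabs (t - z) < d -> w z <= w t).
    { intros t Ht. apply Rabs_def2 in Ht. unfold d in Ht.
      assert (Ht' : a <= t <= b) by lra. specialize (Hmax t Ht'). lra. }
    destruct (classic (In z J)) as [HJ | HJ].
    + exact (jump_not_min z d D HJ Hd Hmin).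
    + assert (Hv : v z <> 0).
      { intros E. pose proof (w_eq D z HJ) as Ew.
        rewrite E in Ew.
        pose proof (A_pos D).
        assert (0 <= A * h ^ 2) by (apply Rmult_le_pos; nra). nra. }
      assert (HnG : n z = G z).
      { pose proof (derive_local_min w z _ d Hd (w_derive D z HJ)
          Hmin) as E.
        pose proof (k_pos D). nra. }
      destruct (critical_escape z d D HJ Hv HnG) as [t [Ht P]].
      * lra.
      * exact Hd.
      * assert (Htz : Rabs (t - z) < d) by (apply Rabs_def1; lra).
        apply Hmin in Htz. nra.
Qed.

Lemma n_incr {A h k gc J v w n G} x y :
  reduced A h k gc J v w n G -> x <= y -> n x <= n y.
Proof.
  intros D [Hxy | ->]; [| lra].
  destruct (mvt n w x y Hxy) as [q [Hq E]].
  - intros t _. apply D.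
  - intros t _. apply (n_cont _ D).
  - pose proof (w_nonneg q D). nra.
Qed.

Lemma n_incr_strict {A h k gc J v w n G} x y :
  reduced A h k gc J v w n G -> x < y -> 0 < w x -> n x < n y.
Proof.
  intros D Hxy Hw.
  destruct (continuous_eps w x (w_cont D x) _ Hw)
    as [d [Hd H]].
  set (p := x + Rmin (d / 2) (y - x)).
  pose proof (Rmin_l (d / 2) (y - x)). pose proof (Rmin_r (d / 2) (y - x)).
  assert (Hp : 0 < Rmin (d / 2) (y - x)) by (apply Rmin_pos; lra).
  apply Rlt_le_trans with (n p).
  - destruct (mvt n w x p) as [q [Hq E]].
    + unfold p; lra.
    + intros t _. apply D.
    + intros t _. apply (n_cont _ D).
    + assert (Hqx : Rabs (q - x) < d) by (unfold p in Hq; apply Rabs_def1; lra).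
      apply H, Rabs_def2 in Hqx.
      assert (0 < w q * (p - x)) by (apply Rmult_lt_0_compat; unfold p; lra). lra.
  - apply (n_incr _ _ D). unfold p; lra.
Qed.

(** A regular sonic point is a global maximum of [w], hence an equilibrium of
    [w' = k (n - G)]. *)
Lemma sonic_point {A h k gc J v w n G} z :
  reduced A h k gc J v w n G -> ~ In z J -> v z = 0 ->
  n z = gc /\ w z = A * h ^ 2 /\ 0 < w z.
Proof.
  intros D HJ Hv.
  pose proof (w_eq D z HJ) as Ew. rewrite Hv in Ew.
  pose proof (A_pos D) as HA.
  pose proof (h_pos D) as Hh.
  pose proof (k_pos D) as Hk.
  assert (0 < A * h ^ 2) by (apply Rmult_lt_0_compat; nra).
  split; [| split; lra].
  rewrite <- (G_sonic D z HJ Hv).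
  destruct (locally_free J z) as [d [Hd Hf]].
  assert (E : k * (n z - G z) = 0).
  { apply (derive_local_max w z _ d Hd (w_derive D z HJ)).
    intros x Hx. destruct (Req_dec x z) as [-> | Hne]; [lra |].
    replace (w z) with (A * h ^ 2) by lra.
    apply (w_le_max _ D). apply Hf; assumption. }
  nra.
Qed.

(** Just before a sonic point [n < g_c]; a subsonic state there would have
    [G > g_c], so [w] would decrease towards its maximum. *)
Lemma sonic_not_after_sub {A h k gc J v w n G} z d :
  reduced A h k gc J v w n G -> ~ In z J -> v z = 0 -> 0 < d ->
  ~ (forall x, z - d < x < z -> ~ In x J /\ v x < 0).
Proof.
  intros D HJ Hv Hd Hsub.
  destruct (sonic_point z D HJ Hv) as [Hn [Hw Hw0]].
  destruct (G_sub D) as [s [Hs HG]].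
  destruct (continuous_eps v z (v_cont D z HJ) s Hs)
    as [d1 [Hd1 H1]].
  pose proof (k_pos D) as Hk.
  set (r := Rmin d d1).
  pose proof (Rmin_l d d1) as R1. pose proof (Rmin_r d d1) as R2. fold r in R1, R2.
  assert (Hr : 0 < r) by (apply Rmin_pos; assumption).
  destruct (mvt w (fun t => k * (n t - G t)) (z - r / 2) z) as [y [Hy E]].
  - lra.
  - intros t Ht. apply D. apply Hsub. lra.
  - intros t _. apply D.
  - destruct (Hsub y) as [HyJ Hvy]; [lra |].
    assert (Hyv : Rabs (y - z) < d1) by (apply Rabs_def1; lra).
    apply H1, Rabs_def2 in Hyv. rewrite Hv in Hyv.
    assert (HGy : gc < G y) by (apply HG; [exact HyJ | lra]).
    assert (Hny : n y <= n z) by (apply (n_incr _ _ D); lra).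
    assert (Hle : w (z - r / 2) <= A * h ^ 2)
      by (apply (w_le_max _ D), Hsub; lra).
    assert (0 < k * (G y - n y)) by (apply Rmult_lt_0_compat; lra).
    assert (0 < k * (G y - n y) * (z - (z - r / 2)))
      by (apply Rmult_lt_0_compat; lra).
    lra.
Qed.

(** Just after a sonic point [n > g_c].  That excludes another sonic point, and
    a supersonic state, where [G < g_c], would push [w] above its maximum. *)
Lemma sub_after_sonic {A h k gc J v w n G} z :
  reduced A h k gc J v w n G -> ~ In z J -> v z = 0 ->
  exists d, 0 < d /\ forall x, z < x < z + d -> ~ In x J /\ v x < 0.
Proof.
  intros D HJ Hv.
  destruct (sonic_point z D HJ Hv) as [Hn [Hw Hw0]].
  pose proof (k_pos D) as Hk.
  destruct (locally_free J z) as [d [Hd Hf]].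
  assert (HfJ : forall x, z <= x < z + d -> ~ In x J).
  { intros x Hx. destruct (Req_dec x z) as [-> | Hne]; [exact HJ |].
    apply Hf; [apply Rabs_def1; lra | exact Hne]. }
  assert (Hv0 : forall x, z < x < z + d -> v x <> 0).
  { intros x Hx E.
    destruct (sonic_point x D (HfJ x ltac:(lra)) E) as [Hn' _].
    assert (n z < n x) by (apply (n_incr_strict _ _ D); lra).
    lra. }
  exists d. split; [exact Hd |]. intros x Hx. split; [apply HfJ; lra |].
  apply Rnot_le_lt. intros [Hpos | E]; [| apply (Hv0 x Hx); auto].
  assert (Hall : forall y, z < y < x -> 0 < v y).
  { intros y Hy. apply Rnot_le_lt. intros [Hneg | E]; [| apply (Hv0 y); auto; lra].
    destruct (ivt v y x) as [q [Hq E]].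
    - lra.
    - intros t Ht. apply D, HfJ. lra.
    - nra.
    - apply (Hv0 q); [lra | exact E]. }
  destruct (mvt w (fun t => k * (n t - G t)) z x) as [y [Hy E]].
  - lra.
  - intros t Ht. apply D, HfJ. lra.
  - intros t _. apply D.
  - assert (HG : G y < gc)
      by (apply (G_super D); [apply HfJ; lra | apply Hall, Hy]).
    assert (Hny : n z <= n y) by (apply (n_incr _ _ D); lra).
    assert (Hle : w x <= A * h ^ 2)
      by (apply (w_le_max _ D), HfJ; lra).
    assert (0 < k * (n y - G y)) by (apply Rmult_lt_0_compat; lra).
    assert (0 < k * (n y - G y) * (x - z)) by (apply Rmult_lt_0_compat; lra).
    lra.
Qed.

Definition transition (J : list R) (v : R -> R) (s : R) : Prop :=
  (forall x, x < s -> ~ In x J /\ 0 < v x) /\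
  (forall x, s < x -> ~ In x J /\ v x < 0) /\
  (In s J \/ (~ In s J /\ v s = 0)).

Lemma continuous_pos_near (f : R -> R) (z : R) : continuous f z -> 0 < f z ->
  exists d, 0 < d /\ forall x, Rabs (x - z) < d -> 0 < f x.
Proof.
  intros Hc Hp. destruct (continuous_eps f z Hc _ Hp) as [d [Hd H]].
  exists d. split; [exact Hd |]. intros x Hx. apply H, Rabs_def2 in Hx. lra.
Qed.

(** Leaving the subsonic side needs a regular sonic point, since jumps go from
    [v > 0] to [v < 0]; [sonic_not_after_sub] rules that out. *)
Lemma transition_exists {A h k gc J v w n G} :
  reduced A h k gc J v w n G -> exists s, transition J v s.
Proof.
  intros D.
  destruct (list_bounded J) as [BJ HBJ].
  destruct (super_m D) as [Bm HBm].
  destruct (sub_p D) as [Bp HBp].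
  set (E := fun x => forall y, y <= x -> ~ In y J /\ 0 < v y).
  destruct (completeness E) as [s [Hub Hlub]].
  { exists (Bp + 1). intros x Hx. apply Rnot_lt_le. intros Hlt.
    destruct (Hx x) as [_ P]; [lra |]. specialize (HBp x). lra. }
  { exists (Rmin (- BJ) Bm - 1). intros y Hy.
    pose proof (Rmin_l (- BJ) Bm). pose proof (Rmin_r (- BJ) Bm).
    split.
    - intros Hin. specialize (HBJ y Hin). lra.
    - apply HBm. lra. }
  assert (Hbefore : forall x, x < s -> ~ In x J /\ 0 < v x).
  { intros x Hx. apply NNPP. intros Hn.
    assert (Hs : s <= x).
    { apply Hlub. intros y Hy. apply Rnot_lt_le. intros Hxy.
      apply Hn, (Hy x). lra. }
    lra. }
  assert (Hat : In s J \/ (~ In s J /\ v s = 0)).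
  { destruct (classic (In s J)) as [HJ | HJ]; [left; exact HJ | right].
    split; [exact HJ |].
    pose proof (v_cont D s HJ) as Hc.
    destruct (Rtotal_order (v s) 0) as [L | [L | L]]; [exfalso | exact L | exfalso].
    - destruct (continuous_pos_near (fun t => - v t) s) as [d [Hd Hp]].
      + apply (continuous_opp v s Hc).
      + lra.
      + specialize (Hp (s - d / 2)).
        assert (P : Rabs (s - d / 2 - s) < d) by (apply Rabs_def1; lra).
        apply Hp in P. destruct (Hbefore (s - d / 2)); lra.
    - destruct (continuous_pos_near v s Hc L) as [d [Hd Hp]].
      destruct (locally_free J s) as [d' [Hd' Hf]].
      set (r := Rmin d d').
      pose proof (Rmin_l d d') as R1. pose proof (Rmin_r d d') as R2. fold r in R1, R2.
      assert (Hr : 0 < r) by (apply Rmin_pos; assumption).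
      assert (He : E (s + r / 2)).
      { intros y Hy. destruct (Rlt_le_dec y s) as [Hys | Hys]; [auto |].
        assert (Hd2 : Rabs (y - s) < r) by (apply Rabs_def1; lra).
        split; [| apply Hp; lra].
        destruct (Req_dec y s) as [-> | Hne]; [exact HJ |].
        apply Hf; [lra | exact Hne]. }
      apply Hub in He. lra. }
  assert (Hnear : exists d, 0 < d /\ forall x, s < x < s + d -> ~ In x J /\ v x < 0).
  { destruct Hat as [HJ | [HJ Hv]].
    - destruct (jump_sign D s HJ) as [q [Hq [_ Hr]]].
      destruct (right_lim_eps v s (- q) Hr q Hq) as [d [Hd H]].
      destruct (locally_free J s) as [d' [Hd' Hf]].
      pose proof (Rmin_l d d') as R1. pose proof (Rmin_r d d') as R2.
      exists (Rmin d d'). split; [apply Rmin_pos; assumption |].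
      intros x Hx. split.
      + apply Hf; [apply Rabs_def1; lra | lra].
      + assert (Hx' : s < x < s + d) by lra. apply H, Rabs_def2 in Hx'. lra.
    - apply (sub_after_sonic s D HJ Hv). }
  destruct Hnear as [d0 [Hd0 Hnear]].
  assert (Hafter : forall x, s < x -> ~ In x J /\ v x < 0).
  { apply NNPP. intros Hn.
    apply not_all_ex_not in Hn. destruct Hn as [x1 Hn].
    apply imply_to_and in Hn. destruct Hn as [Hx1 Hn].
    set (F := fun x => forall y, s < y <= x -> ~ In y J /\ v y < 0).
    destruct (completeness F) as [t [Htub Htlub]].
    { exists x1. intros x Hx. apply Rnot_lt_le. intros Hlt.
      apply Hn, (Hx x1). lra. }
    { exists (s + d0 / 2). intros y Hy. apply Hnear. lra. }
    assert (Hts : s + d0 / 2 <= t).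
    { apply Htub. intros y Hy. apply Hnear. lra. }
    assert (Hbt : forall x, s < x < t -> ~ In x J /\ v x < 0).
    { intros x Hx. apply NNPP. intros Hc.
      assert (Hs : t <= x).
      { apply Htlub. intros y Hy. apply Rnot_lt_le. intros Hxy.
        apply Hc, (Hy x). lra. }
      lra. }
    destruct (classic (In t J)) as [HJ | HJ].
    - destruct (jump_sign D t HJ) as [q [Hq [Hl _]]].
      destruct (left_lim_eps v t q Hl q Hq) as [d [Hd H]].
      set (r := Rmin d (t - s)).
      pose proof (Rmin_l d (t - s)) as R1. pose proof (Rmin_r d (t - s)) as R2.
      fold r in R1, R2.
      assert (Hr : 0 < r) by (apply Rmin_pos; lra).
      assert (Hx' : t - d < t - r / 2 < t) by lra. apply H, Rabs_def2 in Hx'.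
      destruct (Hbt (t - r / 2)); lra.
    - pose proof (v_cont D t HJ) as Hc.
      destruct (Rtotal_order (v t) 0) as [L | [L | L]].
      + destruct (continuous_pos_near (fun t => - v t) t) as [d [Hd Hp]].
        * apply (continuous_opp v t Hc).
        * lra.
        * destruct (locally_free J t) as [d' [Hd' Hf]].
          set (r := Rmin d d').
          pose proof (Rmin_l d d') as R1. pose proof (Rmin_r d d') as R2.
          fold r in R1, R2.
          assert (Hr : 0 < r) by (apply Rmin_pos; assumption).
          assert (He : F (t + r / 2)).
          { intros y Hy. destruct (Rlt_le_dec y t) as [Hyt | Hyt].
            - apply Hbt; lra.
            - assert (Hd2 : Rabs (y - t) < r) by (apply Rabs_def1; lra).
              split; [| specialize (Hp y); lra].
              destruct (Req_dec y t) as [-> | Hne]; [exact HJ |].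
              apply Hf; [lra | exact Hne]. }
          apply Htub in He. lra.
      + apply (sonic_not_after_sub t (t - s) D HJ L); [lra |].
        intros x Hx. apply Hbt. lra.
      + destruct (continuous_pos_near v t Hc L) as [d [Hd Hp]].
        set (r := Rmin d (t - s)).
        pose proof (Rmin_l d (t - s)) as R1. pose proof (Rmin_r d (t - s)) as R2.
        fold r in R1, R2.
        assert (Hr : 0 < r) by (apply Rmin_pos; lra).
        assert (P : Rabs (t - r / 2 - t) < d) by (apply Rabs_def1; lra).
        apply Hp in P. destruct (Hbt (t - r / 2)); lra. }
  exists s. split; [exact Hbefore | split; [exact Hafter | exact Hat]].
Qed.

(** A positive maximum at a regular point, with [w'' = k w > 0], is absurd. *)
Lemma no_positive_max {A h k gc J v w n G} a b c :
  reduced A h k gc J v w n G -> a < c < b ->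
  (forall z, a < z < b -> ~ In z J /\ v z <> 0) ->
  w a < w c -> w b < w c -> False.
Proof.
  intros D Hc Hreg Ha Hb.
  destruct (attains_max w a b c Hc (w_cont D) Ha Hb)
    as [z [Hz [Hcz Hmax]]].
  destruct (Hreg z Hz) as [HJ Hv].
  pose proof (w_nonneg a D) as Hwa.
  set (d := Rmin (z - a) (b - z)).
  pose proof (Rmin_l (z - a) (b - z)) as R1.
  pose proof (Rmin_r (z - a) (b - z)) as R2. fold d in R1, R2.
  assert (Hd : 0 < d) by (apply Rmin_pos; lra).
  assert (Hm : forall t, Rabs (t - z) < d -> w t <= w z).
  { intros t Ht. apply Rabs_def2 in Ht. apply Hmax. lra. }
  assert (HnG : n z = G z).
  { pose proof (derive_local_max w z _ d Hd (w_derive D z HJ) Hm).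
    pose proof (k_pos D). nra. }
  destruct (critical_escape z d D HJ Hv HnG) as [t [Ht P]].
  - lra.
  - exact Hd.
  - assert (Htz : Rabs (t - z) < d) by (apply Rabs_def1; lra).
    apply Hm in Htz. nra.
Qed.

Lemma w_mono_before {A h k gc J v w n G} s a b :
  reduced A h k gc J v w n G -> transition J v s ->
  a <= b -> b < s -> w a <= w b.
Proof.
  intros D [HS _] [Hab | ->] Hbs; [| lra].
  apply Rnot_lt_le. intros Hlt.
  pose proof (w_nonneg b D) as Hwb.
  destruct (is_lim_m_eps w 0 (w_lim_m D) (w a)) as [B HB]; [lra |].
  pose proof (Rmin_l a B). pose proof (Rmin_r a B).
  assert (Hy : Rabs (w (Rmin a B - 1) - 0) < w a) by (apply HB; lra).
  apply Rabs_def2 in Hy.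
  apply (no_positive_max (Rmin a B - 1) b a D); try lra.
  intros z Hz. destruct (HS z); [lra |]. split; [assumption | lra].
Qed.

Lemma w_mono_after {A h k gc J v w n G} s a b :
  reduced A h k gc J v w n G -> transition J v s ->
  s < a -> a <= b -> w b <= w a.
Proof.
  intros D [_ [HB _]] Has [Hab | ->]; [| lra].
  apply Rnot_lt_le. intros Hlt.
  pose proof (w_nonneg a D) as Hwa.
  destruct (is_lim_p_eps w 0 (w_lim_p D) (w b)) as [B H]; [lra |].
  pose proof (Rmax_l b B). pose proof (Rmax_r b B).
  assert (Hy : Rabs (w (Rmax b B + 1) - 0) < w b) by (apply H; lra).
  apply Rabs_def2 in Hy.
  apply (no_positive_max a (Rmax b B + 1) b D); try lra.
  intros z Hz. destruct (HB z); [lra |]. split; [assumption | lra].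
Qed.

(** The end state is not reached at a finite point: looking backwards from the
    first zero [b] of [w], both [n b - n] and [G - G b] are bounded by multiples
    of the monotone [w], so [w <= w / 2] close to [b]. *)
Lemma w_pos_after {A h k gc J v w n G} s x :
  reduced A h k gc J v w n G -> transition J v s -> s < x -> 0 < w x.
Proof.
  intros D T Hx. assert (T' := T). destruct T' as [HS [HB Hat]].
  pose proof (k_pos D) as Hk.
  destruct (w_nonneg x D) as [H | H0]; [exact H | exfalso].
  assert (Hs : 0 < w s).
  { destruct (w_nonneg s D) as [H | Hs]; [exact H | exfalso].
    destruct Hat as [HJ | [HJ Hv]].
    - apply (jump_not_min s 1 D HJ); [lra |].
      intros t _. rewrite <- Hs. apply (w_nonneg t D).
    - destruct (sonic_point s D HJ Hv) as [_ [_ P]]. lra. }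
  set (E := fun y => y <= x /\ 0 < w y).
  destruct (completeness E) as [b [Hub Hlub]].
  { exists x. intros y [Hy _]. exact Hy. }
  { exists s. split; [lra | exact Hs]. }
  assert (Hbx : b <= x) by (apply Hlub; intros y [Hy _]; exact Hy).
  destruct (continuous_pos_near w s (w_cont D s) Hs)
    as [d [Hd Hp]].
  assert (Hsb : s < b).
  { pose proof (Rmin_l (d / 2) (x - s)). pose proof (Rmin_r (d / 2) (x - s)).
    assert (0 < Rmin (d / 2) (x - s)) by (apply Rmin_pos; lra).
    apply Rlt_le_trans with (s + Rmin (d / 2) (x - s)); [lra |].
    apply Hub. split; [lra |]. apply Hp, Rabs_def1; lra. }
  assert (Hbefore : forall y, s < y < b -> 0 < w y).
  { intros y Hy. apply NNPP. intros Hn.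
    assert (b <= y); [| lra].
    apply Hlub. intros q [Hq Hwq]. apply Rnot_lt_le. intros Hyq.
    assert (w q <= w y) by (apply (w_mono_after s y q D T); lra).
    lra. }
  assert (Hwb : w b = 0).
  { destruct (w_nonneg b D) as [P | P]; [exfalso | auto].
    destruct (continuous_pos_near w b (w_cont D b) P)
      as [d1 [Hd1 Hp1]].
    assert (Hne : b <> x) by (intros ->; lra).
    pose proof (Rmin_l (d1 / 2) (x - b)). pose proof (Rmin_r (d1 / 2) (x - b)).
    assert (0 < Rmin (d1 / 2) (x - b)) by (apply Rmin_pos; lra).
    assert (b + Rmin (d1 / 2) (x - b) <= b); [| lra].
    apply Hub. split; [lra |]. apply Hp1, Rabs_def1; lra. }
  destruct (HB b Hsb) as [HbJ Hvb].
  assert (HnG : n b = G b).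
  { assert (Q : k * (n b - G b) = 0).
    { apply (derive_local_min w b _ 1 Rlt_0_1 (w_derive D b HbJ)).
      intros t _. rewrite Hwb. apply (w_nonneg t D). }
    nra. }
  destruct (G_lip D b HbJ) as [L [d2 [HL [Hd2 HG]]]]; [lra |].
  assert (Hc : 0 < 2 * k * (L + 1)) by (repeat apply Rmult_lt_0_compat; lra).
  assert (Hc' : 0 < / (2 * k * (L + 1))) by (apply Rinv_0_lt_compat; exact Hc).
  set (r := Rmin (Rmin 1 d2) (Rmin (b - s) (/ (2 * k * (L + 1))))).
  assert (Hr : 0 < r /\ r <= 1 /\ r <= d2 /\ r <= b - s /\
               r <= / (2 * k * (L + 1))).
  { unfold r.
    pose proof (Rmin_l (Rmin 1 d2) (Rmin (b - s) (/ (2 * k * (L + 1))))).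
    pose proof (Rmin_r (Rmin 1 d2) (Rmin (b - s) (/ (2 * k * (L + 1))))).
    pose proof (Rmin_l 1 d2). pose proof (Rmin_r 1 d2).
    pose proof (Rmin_l (b - s) (/ (2 * k * (L + 1)))).
    pose proof (Rmin_r (b - s) (/ (2 * k * (L + 1)))).
    repeat split; try lra. repeat apply Rmin_pos; lra. }
  destruct Hr as [Hr [Hr1 [Hr2 [Hr3 Hr4]]]].
  set (y := b - r / 2).
  assert (Hwy : 0 < w y) by (apply Hbefore; unfold y; lra).
  destruct (mvt w (fun t => k * (n t - G t)) y b) as [p [Hp' Ep]].
  - unfold y; lra.
  - intros t Ht. apply D, HB. unfold y in Ht; lra.
  - intros t _. apply D.
  - destruct (mvt n w p b) as [q [Hq Eq]].
    + lra.
    + intros t _. apply D.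
    + intros t _. apply (n_cont _ D).
    + assert (M1 : w p <= w y)
        by (apply (w_mono_after s y p D T); unfold y in *; lra).
      assert (M2 : w q <= w y)
        by (apply (w_mono_after s y q D T); unfold y in *; lra).
      pose proof (w_nonneg p D) as P1.
      pose proof (w_nonneg q D) as P2.
      specialize (HG p).
      assert (HGp := HG ltac:(apply Rabs_def1; unfold y in *; lra)).
      rewrite Hwb, Rminus_0_r, (Rabs_right (w p)) in HGp by lra.
      pose proof (Rle_abs (G p - G b)) as Ha.
      assert (Hnp : n b - n p <= w y).
      { rewrite Eq. apply Rle_trans with (w q * 1); [| lra].
        apply Rmult_le_compat_l; unfold y in *; lra. }
      assert (HLw : L * w p <= L * w y) by (apply Rmult_le_compat_l; lra).
      assert (Hbr : G p - n p <= (L + 1) * w y) by lra.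
      assert (Hfin : w y <= k * ((L + 1) * w y) * (b - y)).
      { replace (w y) with (k * (G p - n p) * (b - y)) at 1 by lra.
        apply Rmult_le_compat_r; [unfold y; lra |].
        apply Rmult_le_compat_l; lra. }
      assert (Hsmall : k * (L + 1) * (b - y) <= / 2).
      { replace (b - y) with (r / 2) by (unfold y; lra).
        assert (Hm : 2 * k * (L + 1) * r <= 1).
        { apply Rle_trans with (2 * k * (L + 1) * / (2 * k * (L + 1))).
          - apply Rmult_le_compat_l; lra.
          - right. apply Rinv_r. lra. }
        lra. }
      assert (k * ((L + 1) * w y) * (b - y) <= / 2 * w y).
      { replace (k * ((L + 1) * w y) * (b - y)) with
          (k * (L + 1) * (b - y) * w y) by ring.
        apply Rmult_le_compat_r; lra. }
      lra.
Qed.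

Lemma w_strict_after {A h k gc J v w n G} s a b :
  reduced A h k gc J v w n G -> transition J v s ->
  s < a -> a < b -> w b < w a.
Proof.
  intros D T Ha Hab.
  assert (Hm := fun p q => w_mono_after s p q D T).
  destruct (Hm a b Ha (Rlt_le _ _ Hab)) as [H | E]; [exact H | exfalso].
  assert (Hconst : forall t, a <= t <= b -> w t = w a).
  { intros t Ht. apply Rle_antisym.
    - apply Hm; lra.
    - rewrite <- E. apply Hm; lra. }
  set (z := (a + b) / 2).
  destruct (proj1 (proj2 T) z) as [HzJ Hvz]; [unfold z; lra |].
  set (d := (b - a) / 2).
  assert (Hd : 0 < d) by (unfold d; lra).
  assert (HnG : n z = G z).
  { assert (Q : k * (n z - G z) = 0).
    { apply (derive_local_max w z _ d Hd (w_derive D z HzJ)).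
      intros t Ht. apply Rabs_def2 in Ht.
      rewrite (Hconst t), (Hconst z) by (unfold z, d in *; lra). lra. }
    pose proof (k_pos D). nra. }
  assert (Hwz : 0 < w z)
    by (apply (w_pos_after s z D T); unfold z; lra).
  destruct (critical_escape z d D HzJ) as [t [Ht P]]; auto; try lra.
  rewrite (Hconst t), (Hconst z) in P by (unfold z, d in *; lra). lra.
Qed.

(** [v ^ 2 = h ^ 2 - w / A] turns the monotonicity of [w] on the two sides into
    that of [v]. *)
Lemma v_decr {A h k gc J v w n G} s x y :
  reduced A h k gc J v w n G -> transition J v s ->
  ~ In x J -> ~ In y J -> x < y -> v y <= v x.
Proof.
  intros D T HxJ HyJ Hxy. assert (T' := T). destruct T' as [HS [HB Hat]].
  pose proof (A_pos D) as HA.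
  pose proof (w_eq D x HxJ) as Ex.
  pose proof (w_eq D y HyJ) as Ey.
  assert (Hsgn : forall t, ~ In t J -> (t <= s -> 0 <= v t) /\ (s <= t -> v t <= 0)).
  { intros t HtJ. split; intros [Ht | E].
    - destruct (HS t Ht); lra.
    - subst t. destruct Hat as [HJ | [_ Hv]]; [contradiction | lra].
    - destruct (HB t Ht); lra.
    - subst t. destruct Hat as [HJ | [_ Hv]]; [contradiction | lra]. }
  destruct (Hsgn x HxJ) as [X1 X2]. destruct (Hsgn y HyJ) as [Y1 Y2].
  destruct (Rlt_le_dec y s) as [Hys | Hys].
  - pose proof (w_mono_before s x y D T (Rlt_le _ _ Hxy) Hys).
    assert (v y ^ 2 <= v x ^ 2) by nra.
    destruct (HS x); [lra |]. destruct (HS y); [lra |].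
    apply Rnot_lt_le; intros ?; nra.
  - destruct (Rle_dec x s) as [Hxs | Hxs].
    + specialize (X1 Hxs). specialize (Y2 Hys). lra.
    + pose proof (w_mono_after s x y D T ltac:(lra) (Rlt_le _ _ Hxy)).
      assert (v x ^ 2 <= v y ^ 2) by nra.
      destruct (HB x); [lra |]. destruct (HB y); [lra |].
      apply Rnot_lt_le; intros ?; nra.
Qed.

Lemma v_strict_after {A h k gc J v w n G} s x y :
  reduced A h k gc J v w n G -> transition J v s ->
  s < x -> x < y -> v y < v x.
Proof.
  intros D T Hx Hxy.
  destruct (proj1 (proj2 T) x) as [HxJ Hvx]; [lra |].
  destruct (proj1 (proj2 T) y) as [HyJ Hvy]; [lra |].
  pose proof (A_pos D) as HA.
  pose proof (w_eq D x HxJ) as Ex.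
  pose proof (w_eq D y HyJ) as Ey.
  pose proof (w_strict_after s x y D T Hx Hxy).
  assert (v x ^ 2 < v y ^ 2) by nra.
  apply Rnot_le_lt; intros ?; nra.
Qed.

Lemma v_bounds {A h k gc J v w n G} x :
  reduced A h k gc J v w n G -> ~ In x J -> - h <= v x <= h.
Proof.
  intros D HJ.
  pose proof (A_pos D) as HA.
  pose proof (h_pos D) as Hh.
  pose proof (w_nonneg x D) as Hw.
  rewrite (w_eq D x HJ) in Hw.
  assert (v x ^ 2 <= h ^ 2) by nra.
  split; apply Rnot_lt_le; intros ?; nra.
Qed.

(** * Limits along filters *)

Section Limits.
Context {T : Type} (F : (T -> Prop) -> Prop) {FF : Filter F}.
Implicit Types (f g : T -> R) (a b : R).

Lemma lim_const a : filterlim (fun _ => a) F (locally a).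
Proof. apply (filterlim_const (U := R_UniformSpace)). Qed.

Lemma lim_plus f g a b : filterlim f F (locally a) -> filterlim g F (locally b) ->
  filterlim (fun x => f x + g x) F (locally (a + b)).
Proof.
  intros Hf Hg. eapply filterlim_comp_2; [exact Hf | exact Hg |].
  apply (filterlim_plus (V := R_NormedModule) a b).
Qed.

Lemma lim_mult f g a b : filterlim f F (locally a) -> filterlim g F (locally b) ->
  filterlim (fun x => f x * g x) F (locally (a * b)).
Proof.
  intros Hf Hg. eapply filterlim_comp_2; [exact Hf | exact Hg |].
  apply (filterlim_mult (K := R_AbsRing) a b).
Qed.

Lemma lim_minus f g a b : filterlim f F (locally a) -> filterlim g F (locally b) ->
  filterlim (fun x => f x - g x) F (locally (a - b)).
Proof.
  intros Hf Hg. apply lim_plus; [exact Hf |].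
  eapply filterlim_comp; [exact Hg |].
  apply (filterlim_opp (V := R_NormedModule) b).
Qed.

Lemma lim_sqr f a : filterlim f F (locally a) ->
  filterlim (fun x => f x ^ 2) F (locally (a ^ 2)).
Proof.
  intros Hf. simpl. repeat apply lim_mult; auto using lim_const.
Qed.

End Limits.

Lemma lim_eventually_const {T : Type} (F : (T -> Prop) -> Prop)
    (PF : ProperFilter F) (f : T -> R) (l b : R) :
  filterlim f F (locally l) -> F (fun x => f x = b) -> l = b.
Proof.
  intros Hf Hb.
  apply (filterlim_locally_unique (K := R_AbsRing) (V := R_NormedModule)
           (F := F) f); [exact Hf |].
  apply filterlim_ext_loc with (f := fun _ : T => b).
  - apply (filter_imp (fun x => f x = b)); [intros; auto | exact Hb].
  - apply (lim_const F).
Qed.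

Ltac limits := unfold Rdiv; repeat match goal with
  | |- Filter _ => typeclasses eauto
  | |- filterlim (fun _ => ?a) _ _ => apply (lim_const _ a)
  | |- filterlim (fun x => @?f x + @?g x) _ _ => apply (lim_plus _ f g)
  | |- filterlim (fun x => @?f x - @?g x) _ _ => apply (lim_minus _ f g)
  | |- filterlim (fun x => @?f x * @?g x) _ _ => apply (lim_mult _ f g)
  | |- filterlim (fun x => @?f x ^ 2) _ _ => apply (lim_sqr _ f)
  | _ => assumption
  end.

Lemma off_list_m (J : list R) : Rbar_locally' m_infty (fun x => ~ In x J).
Proof.
  destruct (list_bounded J) as [B HB]. exists (- B). intros x Hx Hin.
  specialize (HB x Hin). lra.
Qed.

Lemma off_list_p (J : list R) : Rbar_locally' p_infty (fun x => ~ In x J).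
Proof.
  destruct (list_bounded J) as [B HB]. exists B. intros x Hx Hin.
  specialize (HB x Hin). lra.
Qed.

Lemma off_list_left (J : list R) z : at_left z (fun x => ~ In x J).
Proof.
  destruct (locally_free J z) as [d [Hd H]].
  exists (mkposreal d Hd). intros y Hy Hlt. apply H; [exact Hy | lra].
Qed.

Lemma off_list_right (J : list R) z : at_right z (fun x => ~ In x J).
Proof.
  destruct (locally_free J z) as [d [Hd H]].
  exists (mkposreal d Hd). intros y Hy Hlt. apply H; [exact Hy | lra].
Qed.

Lemma weak_constant_limit (F : R -> R) (J : list R) (z : Rbar) (l : R) :
  weak_derivative F (fun _ => 0) -> (forall x, ~ In x J -> continuous F x) ->
  Rbar_locally' z (fun x => ~ In x J) ->
  filterlim F (Rbar_locally' z) (locally l) ->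
  forall x, ~ In x J -> F x = l.
Proof.
  intros HF Hc HJ Hl x Hx. symmetry.
  apply (lim_eventually_const (Rbar_locally' z) _ F l (F x) Hl).
  apply (filter_imp (fun y => ~ In y J)); [| exact HJ].
  intros y Hy. apply weak_constant; auto.
Qed.

(** * From the gas profile to the reduced dynamics *)

(** On the momentum balance [R theta = U (Q - U)], where
    [Q = (gam + 1) / gam * Uc]; here [v = U - Uc]. *)
Definition gas_temp (M : medium) (Uc v : R) : R :=
  (Uc + v) * (Uc / gam M - v) / gasR M.

(** Twice the distance, in [v], from the sonic value to the one at which
    [gas_temp] is largest. *)
Definition heat_gap (M : medium) (Uc : R) : R := Uc * (gam M - 1) / gam M.

Lemma gas_temp_diff (M : medium) (Uc a b : R) : medium_ok M ->
  gas_temp M Uc a - gas_temp M Uc b =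
  (b - a) * (a + b + heat_gap M Uc) / gasR M.
Proof.
  intros [HR [Hg _]]. unfold gas_temp, heat_gap. field. lra.
Qed.

Lemma gas_temp_lt (M : medium) (Uc a b : R) : medium_ok M ->
  0 < (b - a) * (a + b + heat_gap M Uc) -> gas_temp M Uc b < gas_temp M Uc a.
Proof.
  intros HM H. pose proof (gas_temp_diff M Uc a b HM) as E.
  assert (0 < (b - a) * (a + b + heat_gap M Uc) / gasR M)
    by (apply Rdiv_lt_0_compat; [exact H | apply HM]).
  lra.
Qed.

Lemma gas_temp_le (M : medium) (Uc a b : R) : medium_ok M ->
  0 <= (b - a) * (a + b + heat_gap M Uc) -> gas_temp M Uc b <= gas_temp M Uc a.
Proof.
  intros HM H. pose proof (gas_temp_diff M Uc a b HM) as E.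
  assert (0 <= (b - a) * (a + b + heat_gap M Uc) / gasR M)
    by (apply Rdiv_le_0_compat; [exact H | apply HM]).
  lra.
Qed.

Lemma heat_gap_pos (M : medium) (Uc : R) : medium_ok M -> 0 < Uc ->
  0 < heat_gap M Uc.
Proof.
  intros [_ [Hg _]] HU. unfold heat_gap.
  apply Rdiv_lt_0_compat; [apply Rmult_lt_0_compat |]; lra.
Qed.

Lemma emission_incr (M : medium) (s t : R) : medium_ok M -> 0 < s < t ->
  emission M s < emission M t.
Proof.
  intros [_ [_ [Ha [Hs _]]]] Hst. unfold emission.
  apply Rmult_lt_compat_l; [exact Hs |].
  apply Rlt_Rpower_l; assumption.
Qed.

Lemma emission_incr_le (M : medium) (s t : R) : medium_ok M -> 0 < s <= t ->
  emission M s <= emission M t.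
Proof.
  intros HM [Hs [Hlt | ->]]; [left; apply emission_incr; auto | lra].
Qed.

Lemma emission_derivable (M : medium) (t : R) : 0 < t ->
  ex_derive (emission M) t.
Proof.
  intros Ht. unfold emission, Rpower. auto_derive. exact Ht.
Qed.

Lemma derivable_lipschitz_at (f : R -> R) (z : R) : ex_derive f z ->
  exists L d, 0 < L /\ 0 < d /\
    forall x, Rabs (x - z) < d -> Rabs (f x - f z) <= L * Rabs (x - z).
Proof.
  intros [l Hl].
  destruct (is_derive_eps f z l Hl 1 Rlt_0_1) as [d [Hd H]].
  exists (1 + Rabs l), d. pose proof (Rabs_pos l).
  split; [lra | split; [exact Hd |]].
  intros x Hx. specialize (H x Hx).
  replace (f x - f z) with ((f x - f z - l * (x - z)) + l * (x - z)) by ring.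
  eapply Rle_trans; [apply Rabs_triang |]. rewrite (Rabs_mult l). lra.
Qed.

Lemma sound_speed_sqr (M : medium) (t : R) : medium_ok M ->
  forall V, 0 < V ->
  (sound_speed M t < V -> gasR M * gam M * t < V ^ 2) /\
  (V < sound_speed M t -> V ^ 2 < gasR M * gam M * t).
Proof.
  intros HM V HV. unfold sound_speed. set (a := gasR M * gam M * t).
  destruct (Rle_dec 0 a) as [Ha | Ha].
  - pose proof (sqrt_sqrt a Ha). pose proof (sqrt_pos a). split; intros; nra.
  - rewrite sqrt_neg_0 by lra. split; intros; nra.
Qed.

(** The conservation laws integrated once: the mass flux is [m], and
    [Uc + h], [Uc - h] are the relative velocities of the end states. *)
Record gas_relations (M : medium) (Sm Sp : state) (c : R) (P : profile)
    (m Uc h : R) : Prop := {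
  mass_pos : 0 < m;
  strength_pos : 0 < h;
  strength_lt : h < Uc / gam M;
  left_velocity : velocity Sm = c + Uc + h;
  right_velocity : velocity Sp = c + Uc - h;
  left_temp : temperature Sm = gas_temp M Uc h;
  right_temp : temperature Sp = gas_temp M Uc (- h);
  mass_flux : forall x, ~ In x (jumps P) -> rho P x * (u P x - c) = m;
  temp_eq : forall x, ~ In x (jumps P) ->
    theta P x = gas_temp M Uc (u P x - c - Uc);
  radiative_flux : forall x, ~ In x (jumps P) ->
    Derive (n P) x = sigma_s M * m * (gam M + 1) / (2 * (gam M - 1))
                     * (h ^ 2 - (u P x - c - Uc) ^ 2) }.

Arguments mass_pos {M Sm Sp c P m Uc h}.
Arguments strength_pos {M Sm Sp c P m Uc h}.
Arguments strength_lt {M Sm Sp c P m Uc h}.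
Arguments left_velocity {M Sm Sp c P m Uc h}.
Arguments right_velocity {M Sm Sp c P m Uc h}.
Arguments left_temp {M Sm Sp c P m Uc h}.
Arguments right_temp {M Sm Sp c P m Uc h}.
Arguments mass_flux {M Sm Sp c P m Uc h}.
Arguments temp_eq {M Sm Sp c P m Uc h}.
Arguments radiative_flux {M Sm Sp c P m Uc h}.

(** A flux with zero weak derivative keeps one value off the jumps, even across
    them, and the state at the end [z] tells which; the last [0] is the limit of
    [n']. *)
Lemma conserved_fluxes (M : medium) (Sm Sp S : state) (c : R) (P : profile)
    (z : Rbar) :
  shock_profile M Sm Sp c P -> profile_limit M S P z ->
  Rbar_locally' z (fun x => ~ In x (jumps P)) ->
  let V := velocity S - c in
  forall x, ~ In x (jumps P) ->
    rho P x * (u P x - c) = density S * V /\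
    rho P x * (u P x - c) ^ 2 + pressure M (rho P x) (theta P x)
      = density S * V ^ 2 + pressure M (density S) (temperature S) /\
    rho P x * (u P x - c) * total_energy M (u P x - c) (theta P x)
      + pressure M (rho P x) (theta P x) * (u P x - c)
      - / sigma_s M * Derive (n P) x
    = density S * V * total_energy M V (temperature S)
      + pressure M (density S) (temperature S) * V - / sigma_s M * 0.
Proof.
  intros [[Hc [_ [_ [_ Hn]]]] [_ [_ [[E1 [E2 [E3 _]]] _]]]]
    [Lr [Lu [Lt [_ Lw]]]] HJ V x Hx.
  unfold total_energy, internal_energy, pressure in *.
  assert (Cr : forall x, ~ In x (jumps P) ->
            filterlim (rho P) (locally x) (locally (rho P x))) by (intros; apply Hc; auto).
  assert (Cu : forall x, ~ In x (jumps P) ->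
            filterlim (u P) (locally x) (locally (u P x))) by (intros; apply Hc; auto).
  assert (Ct : forall x, ~ In x (jumps P) ->
            filterlim (theta P) (locally x) (locally (theta P x))) by (intros; apply Hc; auto).
  assert (Cw : forall x, filterlim (Derive (n P)) (locally x)
            (locally (Derive (n P) x))) by apply Hn.
  assert (Lr' : filterlim (rho P) (Rbar_locally' z) (locally (density S))) by exact Lr.
  assert (Lu' : filterlim (u P) (Rbar_locally' z) (locally (velocity S))) by exact Lu.
  assert (Lt' : filterlim (theta P) (Rbar_locally' z) (locally (temperature S))) by exact Lt.
  assert (Lw' : filterlim (Derive (n P)) (Rbar_locally' z) (locally 0)) by exact Lw.
  clear Lr Lu Lt Lw.
  repeat split.
  - apply (weak_constant_limit _ (jumps P) z _ E1); auto.
    + intros y Hy. specialize (Cr y Hy). specialize (Cu y Hy).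
      unfold continuous. limits.
    + unfold V. limits.
  - apply (weak_constant_limit _ (jumps P) z _ E2); auto.
    + intros y Hy. specialize (Cr y Hy). specialize (Cu y Hy). specialize (Ct y Hy).
      unfold continuous. limits.
    + unfold V. limits.
  - apply (weak_constant_limit _ (jumps P) z _ E3); auto.
    + intros y Hy. specialize (Cr y Hy). specialize (Cu y Hy). specialize (Ct y Hy).
      specialize (Cw y). unfold continuous. limits.
    + unfold V. limits.
Qed.

(** The momentum flux fixes [R theta] as a quadratic in [U], and the energy flux
    then makes [n'] a quadratic in [U] that vanishes at the two end
    velocities. *)
Lemma gas_relations_exist (M : medium) (Sm Sp : state) (c : R) (P : profile) :
  medium_ok M -> state_ok Sm -> state_ok Sp -> one_shock_entropy M Sm Sp c ->
  shock_profile M Sm Sp c P ->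
  exists m Uc h, gas_relations M Sm Sp c P m Uc h.
Proof.
  intros HM HSm HSp [HEm HEp] HP.
  assert (HM' := HM). destruct HM' as [HR [Hg [_ [_ [Hss _]]]]].
  assert (HP' := HP). destruct HP' as [_ [Hpos [_ [_ [Lm Lp]]]]].
  pose proof (conserved_fluxes M Sm Sp Sm c P m_infty HP Lm (off_list_m _)) as Fm.
  pose proof (conserved_fluxes M Sm Sp Sp c P p_infty HP Lp (off_list_p _)) as Fp.
  cbv zeta in Fm, Fp.
  destruct HSm as [Hrm Htm]. destruct HSp as [Hrp Htp].
  set (Um := velocity Sm - c) in *. set (Up := velocity Sp - c) in *.
  set (rm := density Sm) in *. set (rp := density Sp) in *.
  set (tm := temperature Sm) in *. set (tp := temperature Sp) in *.
  assert (HUm : sound_speed M tm < Um) by (unfold Um; lra).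
  assert (HUp : 0 < Up < sound_speed M tp) by (unfold Up; lra).
  assert (HUm0 : 0 < Um)
    by (apply Rle_lt_trans with (sound_speed M tm); [apply sqrt_pos | exact HUm]).
  apply (proj1 (sound_speed_sqr M tm HM Um HUm0)) in HUm.
  destruct HUp as [HUp0 HUp].
  apply (proj2 (sound_speed_sqr M tp HM Up HUp0)) in HUp.
  set (m := rm * Um).
  assert (Hm : 0 < m) by (apply Rmult_lt_0_compat; assumption).
  set (Q := Um + gasR M * tm / Um).
  (* Momentum balance of any state with the mass and momentum flux of [Sm]. *)
  assert (HT : forall r V t, r * V = m ->
    r * V ^ 2 + pressure M r t = rm * Um ^ 2 + pressure M rm tm ->
    gasR M * t = V * (Q - V)).
  { intros r V t E1 E2. unfold pressure in E2.
    assert (E3 : r * V * V + gasR M * r * t = m * Q).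
    { replace (r * V * V + gasR M * r * t) with (r * V ^ 2 + gasR M * r * t) by ring.
      rewrite E2. unfold Q, m. field. lra. }
    assert (E4 : V * (r * V * V + gasR M * r * t) = V * (m * Q)) by (rewrite E3; ring).
    replace (V * (r * V * V + gasR M * r * t))
      with ((r * V) * (V * V + gasR M * t)) in E4 by ring.
    rewrite E1 in E4.
    apply (Rmult_eq_reg_l m); [| lra]. lra. }
  assert (Hx0 : exists x0, ~ In x0 (jumps P)).
  { destruct (list_bounded (jumps P)) as [B HB]. exists B. intros Hin.
    specialize (HB B Hin). lra. }
  destruct Hx0 as [x0 Hx0].
  destruct (Fm x0 Hx0) as [A1 [A2 A3]]. destruct (Fp x0 Hx0) as [B1 [B2 B3]].
  assert (Hmp : rp * Up = m) by (unfold m; lra).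
  assert (HTm : gasR M * tm = Um * (Q - Um)) by (apply (HT rm); auto).
  assert (HTp : gasR M * tp = Up * (Q - Up)) by (apply (HT rp); [exact Hmp | lra]).
  assert (Hord : (gam M + 1) * Up < gam M * Q < (gam M + 1) * Um).
  { split.
    - apply (Rmult_lt_reg_l Up); [exact HUp0 |].
      replace (gasR M * gam M * tp) with (gam M * (Up * (Q - Up))) in HUp
        by (rewrite <- HTp; ring). nra.
    - apply (Rmult_lt_reg_l Um); [exact HUm0 |].
      replace (gasR M * gam M * tm) with (gam M * (Um * (Q - Um))) in HUm
        by (rewrite <- HTm; ring). nra. }
  assert (Hlt : Up < Um) by nra.
  assert (HEn : forall r V t, r * V = m -> gasR M * t = V * (Q - V) ->
    r * V * total_energy M V t + pressure M r t * V =
    m * (V ^ 2 / 2 + gam M / (gam M - 1) * (V * (Q - V)))).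
  { intros r V t E1 E2. unfold total_energy, internal_energy, pressure.
    replace (gasR M * r * t * V) with (r * V * (gasR M * t)) by ring.
    replace (gasR M / (gam M - 1) * t) with (gasR M * t / (gam M - 1)) by (field; lra).
    rewrite E1, E2. field. lra. }
  assert (HQ : gam M * Q = (gam M + 1) * ((Um + Up) / 2)).
  { rewrite (HEn rm Um tm eq_refl HTm) in A3.
    rewrite (HEn rp Up tp Hmp HTp) in B3.
    assert (E : m * ((Um - Up) * ((Um + Up) / 2
              + gam M / (gam M - 1) * (Q - Um - Up))) = 0).
    { replace (m * ((Um - Up) * ((Um + Up) / 2
              + gam M / (gam M - 1) * (Q - Um - Up)))) with
        (m * (Um ^ 2 / 2 + gam M / (gam M - 1) * (Um * (Q - Um)))
         - m * (Up ^ 2 / 2 + gam M / (gam M - 1) * (Up * (Q - Up))))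
        by (field; lra). lra. }
    apply Rmult_integral in E. destruct E as [E | E]; [lra |].
    apply Rmult_integral in E. destruct E as [E | E]; [lra |].
    apply (Rmult_eq_compat_l (gam M - 1)) in E.
    replace ((gam M - 1) * ((Um + Up) / 2 + gam M / (gam M - 1) * (Q - Um - Up)))
      with ((gam M - 1) * ((Um + Up) / 2) + gam M * (Q - Um - Up)) in E
      by (field; lra).
    lra. }
  set (Uc := (Um + Up) / 2) in *.
  assert (HQ' : Q = Uc + Uc / gam M).
  { apply (Rmult_eq_reg_l (gam M)); [| lra]. rewrite HQ. field. lra. }
  assert (HTt : forall V t, gasR M * t = V * (Q - V) -> t = gas_temp M Uc (V - Uc)).
  { intros V t E. unfold gas_temp.
    apply (Rmult_eq_reg_l (gasR M)); [| lra]. rewrite E, HQ'. field. lra. }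
  exists m, Uc, ((Um - Up) / 2).
  split.
  - exact Hm.
  - lra.
  - assert (0 < Q - Um).
    { apply (Rmult_lt_reg_l Um); [exact HUm0 |]. rewrite <- HTm, Rmult_0_r.
      apply Rmult_lt_0_compat; assumption. }
    unfold Uc in *. lra.
  - unfold Uc, Um; lra.
  - unfold Uc, Um, Up; lra.
  - fold tm. rewrite (HTt Um tm HTm). f_equal. unfold Uc; field.
  - fold tp. rewrite (HTt Up tp HTp). f_equal. unfold Uc; field.
  - intros x Hx. apply Fm, Hx.
  - intros x Hx. destruct (Fm x Hx) as [E1 [E2 _]].
    apply HTt, (HT (rho P x)); assumption.
  - intros x Hx. destruct (Fm x Hx) as [E1 [E2 E3]].
    rewrite (HEn rm Um tm eq_refl HTm) in E3.
    rewrite (HEn (rho P x) (u P x - c) (theta P x) E1) in E3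
      by (apply (HT (rho P x)); assumption).
    set (V := u P x - c) in *.
    apply (Rmult_eq_reg_l (/ sigma_s M)); [| apply Rinv_neq_0_compat; lra].
    replace (/ sigma_s M * Derive (n P) x) with
      (m * (V ^ 2 / 2 + gam M / (gam M - 1) * (V * (Q - V)))
       - m * (Um ^ 2 / 2 + gam M / (gam M - 1) * (Um * (Q - Um)))) by lra.
    rewrite HQ'. unfold Uc. field. lra.
Qed.

Lemma Uc_bound {M Sm Sp c P m Uc h} : medium_ok M ->
  gas_relations M Sm Sp c P m Uc h -> h < Uc.
Proof.
  intros [_ [Hg _]] H. pose proof (strength_lt H) as H1.
  pose proof (strength_pos H) as H2.
  assert (E : Uc = gam M * (Uc / gam M)) by (field; lra). nra.
Qed.

(** The two sides of a jump have the same [n'], hence opposite [v]; the entropy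
    inequalities say on which side of the sonic value each lies. *)
Lemma jump_states {M Sm Sp c P m Uc h} z : medium_ok M ->
  shock_profile M Sm Sp c P -> gas_relations M Sm Sp c P m Uc h ->
  In z (jumps P) ->
  exists s rl rr, 0 < s /\
    left_lim (rho P) z rl /\ right_lim (rho P) z rr /\
    left_lim (u P) z (c + Uc + s) /\ right_lim (u P) z (c + Uc - s) /\
    left_lim (theta P) z (gas_temp M Uc s) /\
    right_lim (theta P) z (gas_temp M Uc (- s)) /\
    rl <> rr /\ 0 <= gas_temp M Uc s.
Proof.
  intros HM HP Hg Hz.
  assert (HM' := HM). destruct HM' as [HR [Hgam [_ [_ [Hss _]]]]].
  destruct HP as [[_ [_ [_ [_ Hn]]]] [Hpos [Hj _]]].
  destruct (Hj z Hz) as [rl [rr [ul [ur [tl [tr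
    [Lrl [Lrr [Lul [Lur [Ltl [Ltr [Sl [Sr Sr']]]]]]]]]]]]]].
  pose proof (mass_pos Hg) as Hm. pose proof (strength_pos Hg) as Hh.
  pose proof (Uc_bound HM Hg) as HUc.
  (* The pointwise relations pass to both one-sided limits. *)
  assert (Key : forall (F : (R -> Prop) -> Prop) (PF : ProperFilter F) (r V t : R),
    filterlim (rho P) F (locally r) -> filterlim (u P) F (locally V) ->
    filterlim (theta P) F (locally t) ->
    filterlim (Derive (n P)) F (locally (Derive (n P) z)) ->
    F (fun x => ~ In x (jumps P)) ->
    r * (V - c) = m /\ t = gas_temp M Uc (V - c - Uc) /\
    Derive (n P) z = sigma_s M * m * (gam M + 1) / (2 * (gam M - 1))
                     * (h ^ 2 - (V - c - Uc) ^ 2)).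
  { intros F PF r V t L1 L2 L3 L4 HF. repeat split.
    - apply (lim_eventually_const F PF (fun x => rho P x * (u P x - c))).
      + limits.
      + apply (filter_imp (fun x => ~ In x (jumps P))); [| exact HF].
        intros x Hx. apply (mass_flux Hg), Hx.
    - apply Rminus_diag_uniq.
      apply (lim_eventually_const F PF
               (fun x => theta P x - gas_temp M Uc (u P x - c - Uc))).
      + unfold gas_temp. limits.
      + apply (filter_imp (fun x => ~ In x (jumps P))); [| exact HF].
        intros x Hx. rewrite (temp_eq Hg x Hx). ring.
    - apply Rminus_diag_uniq.
      apply (lim_eventually_const F PF
         (fun x => Derive (n P) x - sigma_s M * m * (gam M + 1) / (2 * (gam M - 1))
                   * (h ^ 2 - (u P x - c - Uc) ^ 2))).
      + limits.
      + apply (filter_imp (fun x => ~ In x (jumps P))); [| exact HF].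
        intros x Hx. rewrite (radiative_flux Hg x Hx). ring. }
  assert (Wl : filterlim (Derive (n P)) (at_left z) (locally (Derive (n P) z))).
  { apply (filterlim_filter_le_1 _ (filter_le_within (F := locally z) _)), Hn. }
  assert (Wr : filterlim (Derive (n P)) (at_right z) (locally (Derive (n P) z))).
  { apply (filterlim_filter_le_1 _ (filter_le_within (F := locally z) _)), Hn. }
  destruct (Key _ (at_left_proper_filter z) rl ul tl Lrl Lul Ltl Wl
              (off_list_left _ z)) as [Kl1 [Kl2 Kl3]].
  destruct (Key _ (at_right_proper_filter z) rr ur tr Lrr Lur Ltr Wr
              (off_list_right _ z)) as [Kr1 [Kr2 Kr3]].
  assert (Hul : 0 < ul - c)
    by (apply Rle_lt_trans with (sound_speed M tl); [apply sqrt_pos | exact Sl]).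
  apply (proj1 (sound_speed_sqr M tl HM _ Hul)) in Sl.
  apply (proj2 (sound_speed_sqr M tr HM _ Sr)) in Sr'.
  assert (Hrel : forall t v, t = gas_temp M Uc v ->
            gasR M * gam M * t = (Uc + v) * (Uc - gam M * v)).
  { intros t v ->. unfold gas_temp. field. lra. }
  rewrite (Hrel tl _ Kl2) in Sl. rewrite (Hrel tr _ Kr2) in Sr'.
  assert (Hl : 0 < ul - c - Uc).
  { apply Rnot_le_lt. intros Hle.
    assert (0 <= (ul - c) * ((gam M + 1) * - (ul - c - Uc)))
      by (apply Rmult_le_pos; [lra | apply Rmult_le_pos; lra]). nra. }
  assert (Hr : ur - c - Uc < 0).
  { apply Rnot_le_lt. intros Hle.
    assert (0 <= (ur - c) * ((gam M + 1) * (ur - c - Uc)))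
      by (apply Rmult_le_pos; [lra | apply Rmult_le_pos; lra]). nra. }
  set (s := ul - c - Uc) in *.
  assert (Hsr : ur - c - Uc = - s).
  { set (A := sigma_s M * m * (gam M + 1) / (2 * (gam M - 1))) in *.
    assert (HA : 0 < A).
    { apply Rdiv_lt_0_compat; [| lra]. repeat apply Rmult_lt_0_compat; lra. }
    assert (E : A * ((s + (ur - c - Uc)) * (s - (ur - c - Uc))) = 0) by lra.
    apply Rmult_integral in E. destruct E as [E | E]; [lra |].
    apply Rmult_integral in E. destruct E as [E | E]; lra. }
  exists s, rl, rr.
  replace (c + Uc + s) with ul by (unfold s; ring).
  replace (c + Uc - s) with ur by lra.
  rewrite <- Hsr, <- Kl2, <- Kr2.
  repeat split; auto.
  - intros E. subst rr.
    assert (Ez : rl * (ul - ur) = 0) by lra.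
    apply Rmult_integral in Ez. destruct Ez as [Ez | Ez].
    + rewrite Ez in Kl1. lra.
    + unfold s in *. lra.
  - apply Rnot_lt_le. intros Hneg.
    destruct (left_lim_eps (theta P) z tl Ltl (- tl)) as [d [Hd H]]; [lra |].
    destruct (locally_free (jumps P) z) as [d' [Hd' Hf]].
    pose proof (Rmin_l d d') as R1. pose proof (Rmin_r d d') as R2.
    assert (Hmin : 0 < Rmin d d') by (apply Rmin_pos; assumption).
    set (y := z - Rmin d d' / 2).
    assert (Hy : z - d < y < z) by (unfold y; lra).
    apply H, Rabs_def2 in Hy.
    destruct (Hpos y) as [_ P2]; [| lra].
    apply Hf; [apply Rabs_def1 |]; unfold y; lra.
Qed.

Lemma reduced_profile {M Sm Sp c P m Uc h} : medium_ok M ->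
  shock_profile M Sm Sp c P -> gas_relations M Sm Sp c P m Uc h ->
  reduced (sigma_s M * m * (gam M + 1) / (2 * (gam M - 1))) h (tau M ^ 2)
    (emission M (gas_temp M Uc 0)) (jumps P)
    (fun x => u P x - c - Uc) (Derive (n P)) (n P)
    (fun x => emission M (theta P x)).
Proof.
  intros HM HP Hg.
  pose proof (fun z => @jump_states M Sm Sp c P m Uc h z HM HP Hg) as HJS.
  assert (HM' := HM). destruct HM' as [HR [Hgam [Hal [Hsi [Hss Hta]]]]].
  destruct HP as [[Hc [_ [_ [_ Hn]]]] [Hpos [_ [[_ [_ [_ E4]]] [Lm Lp]]]]].
  pose proof (mass_pos Hg) as Hm. pose proof (strength_pos Hg) as Hh.
  pose proof (Uc_bound HM Hg) as HUc.
  pose proof (heat_gap_pos M Uc HM ltac:(lra)) as Hgap.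
  set (A := sigma_s M * m * (gam M + 1) / (2 * (gam M - 1))).
  assert (HA : 0 < A).
  { apply Rdiv_lt_0_compat; [| lra]. repeat apply Rmult_lt_0_compat; lra. }
  assert (Hcv : forall x, ~ In x (jumps P) ->
            continuous (fun x => u P x - c - Uc) x).
  { intros x Hx. destruct (Hc x Hx) as [_ [Cu _]].
    unfold continuous in *. limits. }
  assert (Hcn : forall x, continuous (n P) x)
    by (intros x; apply (ex_derive_continuous (n P)), Hn).
  assert (Ht0 : 0 < gas_temp M Uc 0).
  { unfold gas_temp. apply Rdiv_lt_0_compat; [| exact HR].
    apply Rmult_lt_0_compat; [lra |].
    assert (0 < Uc / gam M) by (apply Rdiv_lt_0_compat; lra). lra. }
  constructor.
  - exact HA.
  - exact Hh.
  - apply pow_lt, Hta.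
  - intros x. apply Derive_correct, Hn.
  - intros x. apply Hn.
  - exact Hcv.
  - intros x Hx. apply (radiative_flux Hg), Hx.
  - intros x Hx.
    destruct (locally_free (jumps P) x) as [d [Hd Hf]].
    apply (weak_derivative_classical (Derive (n P))
      (fun t => tau M ^ 2 * (n P t - emission M (theta P t))) x d E4 Hd).
    intros t Ht.
    assert (HtJ : ~ In t (jumps P)).
    { destruct (Req_dec t x) as [-> | Hne]; [exact Hx | apply Hf; assumption]. }
    split; [apply Hn |].
    destruct (Hc t HtJ) as [_ [_ Ct]]. destruct (Hpos t HtJ) as [_ Pt].
    assert (Ce : filterlim (fun y => emission M (theta P y)) (locally t)
                   (locally (emission M (theta P t)))).
    { apply (continuous_comp (theta P) (emission M)); [exact Ct |].
      apply (ex_derive_continuous (emission M)), emission_derivable, Pt. }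
    pose proof (Hcn t) as Cn. unfold continuous in *. limits.
  - intros z Hz Hv.
    destruct (Hpos z Hz) as [_ Pz].
    destruct (derivable_lipschitz_at _ _ (emission_derivable M _ Pz))
      as [L1 [d1 [HL1 [Hd1 H1]]]].
    destruct (Hc z Hz) as [_ [_ Ct]].
    destruct (continuous_eps _ z Ct d1 Hd1) as [d2 [Hd2 H2]].
    set (v := fun x => u P x - c - Uc) in *.
    assert (Hav : 0 < Rabs (v z)) by (apply Rabs_pos_lt; exact Hv).
    destruct (continuous_eps v z (Hcv z Hz) (Rabs (v z)) Hav) as [d3 [Hd3 H3]].
    destruct (locally_free (jumps P) z) as [d4 [Hd4 H4]].
    set (C := (3 * Rabs (v z) + heat_gap M Uc) / gasR M).
    assert (HC : 0 < C) by (apply Rdiv_lt_0_compat; lra).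
    exists (L1 * (C * / (A * Rabs (v z)))), (Rmin d2 (Rmin d3 d4)).
    split; [| split; [repeat apply Rmin_pos; assumption |]].
    { apply Rmult_lt_0_compat; [exact HL1 |].
      apply Rmult_lt_0_compat; [exact HC |].
      apply Rinv_0_lt_compat, Rmult_lt_0_compat; assumption. }
    intros x Hx.
    pose proof (Rmin_l d2 (Rmin d3 d4)). pose proof (Rmin_r d2 (Rmin d3 d4)).
    pose proof (Rmin_l d3 d4). pose proof (Rmin_r d3 d4).
    assert (HxJ : ~ In x (jumps P)).
    { destruct (Req_dec x z) as [-> | Hne]; [exact Hz | apply H4; lra]. }
    eapply Rle_trans; [apply H1, H2; lra |].
    rewrite (Rmult_assoc L1). apply Rmult_le_compat_l; [lra |].
    assert (Hx3 : Rabs (v x - v z) < Rabs (v z)) by (apply H3; lra).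
    rewrite (temp_eq Hg x HxJ), (temp_eq Hg z Hz).
    rewrite (radiative_flux Hg x HxJ), (radiative_flux Hg z Hz). fold A.
    change (u P x - c - Uc) with (v x). change (u P z - c - Uc) with (v z).
    rewrite gas_temp_diff by exact HM.
    replace (A * (h ^ 2 - v x ^ 2) - A * (h ^ 2 - v z ^ 2))
      with (A * ((v x - v z) * - (v x + v z))) by ring.
    assert (Hlow : Rabs (v z) <= Rabs (v x + v z)).
    { replace (v x + v z) with ((v x - v z) - - (2 * v z)) by ring.
      pose proof (Rabs_triang_inv (- (2 * v z)) (v x - v z)) as T.
      rewrite (Rabs_minus_sym (- (2 * v z)) (v x - v z)) in T.
      rewrite Rabs_Ropp, Rabs_mult, (Rabs_right 2) in T by lra. lra. }
    assert (Hup : Rabs (v x + v z + heat_gap M Uc)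
                  <= 3 * Rabs (v z) + heat_gap M Uc).
    { replace (v x + v z + heat_gap M Uc)
        with ((v x - v z) + (2 * v z + heat_gap M Uc)) by ring.
      eapply Rle_trans; [apply Rabs_triang |].
      pose proof (Rabs_triang (2 * v z) (heat_gap M Uc)) as T.
      rewrite Rabs_mult, (Rabs_right 2), (Rabs_right (heat_gap M Uc)) in T by lra.
      lra. }
    unfold Rdiv. rewrite !Rabs_mult, Rabs_Ropp.
    rewrite (Rabs_right (/ gasR M))
      by (apply Rle_ge; left; apply Rinv_0_lt_compat, HR).
    rewrite (Rabs_right A) by lra.
    rewrite (Rabs_minus_sym (v z) (v x)).
    set (D := Rabs (v x - v z)) in *.
    assert (HD : 0 <= D) by apply Rabs_pos.
    apply Rle_trans with (D * C).
    + unfold C, Rdiv. rewrite <- !Rmult_assoc.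
      apply Rmult_le_compat_r; [left; apply Rinv_0_lt_compat, HR |].
      apply Rmult_le_compat_l; assumption.
    + replace (D * C) with (C * / (A * Rabs (v z)) * (A * (D * Rabs (v z))))
        by (field; lra).
      apply Rmult_le_compat_l.
      * left. apply Rmult_lt_0_compat; [exact HC |].
        apply Rinv_0_lt_compat, Rmult_lt_0_compat; assumption.
      * apply Rmult_le_compat_l; [lra |]. apply Rmult_le_compat_l; assumption.
  - intros x Hx Hv. rewrite (temp_eq Hg x Hx), Hv. reflexivity.
  - intros x Hx Hv. apply emission_incr; [exact HM |].
    split; [apply Hpos, Hx |]. rewrite (temp_eq Hg x Hx).
    apply gas_temp_lt; [exact HM |]. apply Rmult_lt_0_compat; lra.
  - exists (heat_gap M Uc). split; [exact Hgap |].
    intros x Hx Hv. apply emission_incr; [exact HM |]. split; [exact Ht0 |].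
    rewrite (temp_eq Hg x Hx).
    apply gas_temp_lt; [exact HM |]. apply Rmult_lt_0_compat; lra.
  - intros z Hz.
    destruct (HJS z Hz) as [s [rl [rr [Hs [_ [_ [Ll [Lr _]]]]]]]].
    exists s. split; [exact Hs |]. unfold left_lim, right_lim in *.
    replace s with (c + Uc + s - c - Uc) at 1 by ring.
    replace (- s) with (c + Uc - s - c - Uc) by ring.
    split; limits.
  - intros z Hz.
    destruct (HJS z Hz) as [s [rl [rr [Hs [_ [_ [_ [_ [Ll [Lr [_ Hnn]]]]]]]]]]].
    set (tl := gas_temp M Uc s) in *. set (tr := gas_temp M Uc (- s)) in *.
    assert (Hlt : tl < tr)
      by (apply gas_temp_lt; [exact HM |]; apply Rmult_lt_0_compat; lra).
    set (e := (tr - tl) / 3).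
    assert (He : 0 < e) by (unfold e; lra).
    destruct (left_lim_eps _ _ _ Ll e He) as [d1 [Hd1 H1]].
    destruct (right_lim_eps _ _ _ Lr e He) as [d2 [Hd2 H2]].
    destruct (locally_free (jumps P) z) as [d3 [Hd3 H3]].
    exists (emission M (tl + e)), (emission M (tr - e)), (Rmin d1 (Rmin d2 d3)).
    pose proof (Rmin_l d1 (Rmin d2 d3)). pose proof (Rmin_r d1 (Rmin d2 d3)).
    pose proof (Rmin_l d2 d3). pose proof (Rmin_r d2 d3).
    split; [apply emission_incr; [exact HM | unfold e in *; lra] |].
    split; [repeat apply Rmin_pos; assumption |].
    split; intros x Hx.
    + assert (Hx1 : z - d1 < x < z) by lra. apply H1, Rabs_def2 in Hx1.
      apply emission_incr_le; [exact HM |]. split; [| lra].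
      apply Hpos, H3; [apply Rabs_def1; lra | lra].
    + assert (Hx1 : z < x < z + d2) by lra. apply H2, Rabs_def2 in Hx1.
      apply emission_incr_le; [exact HM |]. unfold e in *; lra.
  - destruct Lm as [_ [Lu _]].
    destruct (is_lim_m_eps _ _ Lu h Hh) as [B HB]. exists B. intros x Hx.
    specialize (HB x Hx). apply Rabs_def2 in HB.
    pose proof (left_velocity Hg). lra.
  - destruct Lp as [_ [Lu _]].
    destruct (is_lim_p_eps _ _ Lu h Hh) as [B HB]. exists B. intros x Hx.
    specialize (HB x Hx). apply Rabs_def2 in HB.
    pose proof (right_velocity Hg). lra.
  - apply Lm.
  - apply Lp.
Qed.

(** * One-sided values *)

Lemma at_left_subfilter x : filter_le (at_left x) (locally x).
Proof. apply (filter_le_within (F := locally x)). Qed.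

Lemma at_right_subfilter x : filter_le (at_right x) (locally x).
Proof. apply (filter_le_within (F := locally x)). Qed.

Lemma one_sided_value_jump (f : R -> R) (x l r v : R) :
  left_lim f x l -> right_lim f x r -> one_sided_value f x v -> v = l \/ v = r.
Proof.
  intros Hl Hr [H | H]; [left | right].
  - apply (filterlim_locally_unique (K := R_AbsRing) (V := R_NormedModule)
             (F := at_left x) f); assumption.
  - apply (filterlim_locally_unique (K := R_AbsRing) (V := R_NormedModule)
             (F := at_right x) f); assumption.
Qed.

Lemma continuous_one_sided (f : R -> R) (x : R) : continuous f x ->
  left_lim f x (f x) /\ right_lim f x (f x).
Proof.
  intros Hc. split.
  - apply (filterlim_filter_le_1 _ (at_left_subfilter x)), Hc.
  - apply (filterlim_filter_le_1 _ (at_right_subfilter x)), Hc.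
Qed.

Lemma one_sided_value_continuous (f : R -> R) (x v : R) : continuous f x ->
  one_sided_value f x v -> v = f x.
Proof.
  intros Hc Hv. destruct (continuous_one_sided f x Hc) as [Hl Hr].
  destruct (one_sided_value_jump f x _ _ v Hl Hr Hv); assumption.
Qed.

Lemma one_sided_value_near (f : R -> R) (J : list R) (x v e : R) : 0 < e ->
  one_sided_value f x v -> exists y, ~ In y J /\ Rabs (f y - v) < e.
Proof.
  intros He H. destruct (locally_free J x) as [d' [Hd' Hf]].
  destruct H as [H | H].
  - destruct (left_lim_eps f x v H e He) as [d [Hd H']].
    pose proof (Rmin_l d d'). pose proof (Rmin_r d d').
    assert (0 < Rmin d d') by (apply Rmin_pos; assumption).
    exists (x - Rmin d d' / 2). split; [apply Hf | apply H']; try lra.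
    apply Rabs_def1; lra.
  - destruct (right_lim_eps f x v H e He) as [d [Hd H']].
    pose proof (Rmin_l d d'). pose proof (Rmin_r d d').
    assert (0 < Rmin d d') by (apply Rmin_pos; assumption).
    exists (x + Rmin d d' / 2). split; [apply Hf | apply H']; try lra.
    apply Rabs_def1; lra.
Qed.

Lemma left_lim_le (f : R -> R) (a x l b : R) : a < x -> left_lim f x l ->
  (forall y, a < y < x -> f y <= b) -> l <= b.
Proof.
  intros Ha Hl H. apply Rnot_lt_le. intros Hlt.
  destruct (left_lim_eps f x l Hl (l - b)) as [d [Hd Hd']]; [lra |].
  pose proof (Rmin_l d (x - a)). pose proof (Rmin_r d (x - a)).
  assert (0 < Rmin d (x - a)) by (apply Rmin_pos; lra).
  set (y := x - Rmin d (x - a) / 2).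
  assert (Hin : x - d < y < x) by (unfold y; lra).
  apply Hd', Rabs_def2 in Hin. specialize (H y ltac:(unfold y; lra)). lra.
Qed.

Lemma right_lim_le (f : R -> R) (a x l b : R) : x < a -> right_lim f x l ->
  (forall y, x < y < a -> f y <= b) -> l <= b.
Proof.
  intros Ha Hl H. apply Rnot_lt_le. intros Hlt.
  destruct (right_lim_eps f x l Hl (l - b)) as [d [Hd Hd']]; [lra |].
  pose proof (Rmin_l d (a - x)). pose proof (Rmin_r d (a - x)).
  assert (0 < Rmin d (a - x)) by (apply Rmin_pos; lra).
  set (y := x + Rmin d (a - x) / 2).
  assert (Hin : x < y < x + d) by (unfold y; lra).
  apply Hd', Rabs_def2 in Hin. specialize (H y ltac:(unfold y; lra)). lra.
Qed.

Lemma right_lim_ge (f : R -> R) (a x l b : R) : x < a -> right_lim f x l ->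
  (forall y, x < y < a -> b <= f y) -> b <= l.
Proof.
  intros Ha Hl H. apply Rnot_lt_le. intros Hlt.
  destruct (right_lim_eps f x l Hl (b - l)) as [d [Hd Hd']]; [lra |].
  pose proof (Rmin_l d (a - x)). pose proof (Rmin_r d (a - x)).
  assert (0 < Rmin d (a - x)) by (apply Rmin_pos; lra).
  set (y := x + Rmin d (a - x) / 2).
  assert (Hin : x < y < x + d) by (unfold y; lra).
  apply Hd', Rabs_def2 in Hin. specialize (H y ltac:(unfold y; lra)). lra.
Qed.

(** A monotone function stays below the larger of its two end values. *)
Lemma internal_max_not_monotone (f : R -> R) (J : list R) (fm fp x0 v0 : R) :
  is_lim f m_infty fm -> is_lim f p_infty fp ->
  internal_absolute_max f fm fp x0 v0 -> ~ monotone_off J f.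
Proof.
  intros Lm Lp [Hv [_ [_ [Hm Hp]]]] Hmon.
  destruct (list_bounded J) as [B HB].
  destruct Hmon as [Hmon | Hmon].
  - destruct (one_sided_value_near f J x0 v0 (v0 - fp)) as [y [HyJ Hy]];
      [lra | exact Hv |].
    apply Rabs_def2 in Hy.
    destruct (is_lim_p_eps f fp Lp (f y - fp)) as [B' HB']; [lra |].
    pose proof (Rmax_l B (Rmax B' y)). pose proof (Rmax_r B (Rmax B' y)).
    pose proof (Rmax_l B' y). pose proof (Rmax_r B' y).
    set (t := Rmax B (Rmax B' y) + 1).
    assert (HtJ : ~ In t J) by (intros Hin; specialize (HB t Hin); unfold t in *; lra).
    assert (Ht : Rabs (f t - fp) < f y - fp) by (apply HB'; unfold t; lra).
    apply Rabs_def2 in Ht.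
    specialize (Hmon y t HyJ HtJ ltac:(unfold t; lra)). lra.
  - destruct (one_sided_value_near f J x0 v0 (v0 - fm)) as [y [HyJ Hy]];
      [lra | exact Hv |].
    apply Rabs_def2 in Hy.
    destruct (is_lim_m_eps f fm Lm (f y - fm)) as [B' HB']; [lra |].
    pose proof (Rmin_l (- B) (Rmin B' y)). pose proof (Rmin_r (- B) (Rmin B' y)).
    pose proof (Rmin_l B' y). pose proof (Rmin_r B' y).
    set (t := Rmin (- B) (Rmin B' y) - 1).
    assert (HtJ : ~ In t J) by (intros Hin; specialize (HB t Hin); unfold t in *; lra).
    assert (Ht : Rabs (f t - fm) < f y - fm) by (apply HB'; unfold t; lra).
    apply Rabs_def2 in Ht.
    specialize (Hmon t y HtJ HyJ ltac:(unfold t; lra)). lra.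
Qed.

(** * Jumps and temperature peaks *)

Lemma shock_strength_eq {M Sm Sp c P m Uc h} :
  medium_ok M -> gas_relations M Sm Sp c P m Uc h ->
  shock_strength Sm Sp c = 2 * h / Uc.
Proof.
  intros HM Hg. pose proof (strength_pos Hg) as Hh.
  pose proof (Uc_bound HM Hg) as HU.
  unfold shock_strength. rewrite (left_velocity Hg), (right_velocity Hg).
  replace (c + Uc - h - c - (c + Uc + h - c)) with (- (2 * h)) by ring.
  rewrite Rabs_Ropp, Rabs_right by lra. field. lra.
Qed.

Lemma delta_jump_iff {M Sm Sp c P m Uc h} :
  medium_ok M -> gas_relations M Sm Sp c P m Uc h ->
  shock_strength Sm Sp c >= delta_jump M <-> heat_gap M Uc <= h.
Proof.
  intros HM Hg. pose proof (strength_pos Hg) as Hh.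
  pose proof (Uc_bound HM Hg) as HU.
  rewrite (shock_strength_eq HM Hg). unfold delta_jump, heat_gap.
  assert (Hgam : 1 < gam M) by apply HM.
  replace (Uc * (gam M - 1) / gam M)
    with (Uc / 2 * (2 * (gam M - 1) / gam M)) by (field; lra).
  set (d := 2 * (gam M - 1) / gam M).
  replace (2 * h / Uc) with (h / (Uc / 2)) by (field; lra).
  split; intros H.
  - apply Rge_le, (Rmult_le_compat_l (Uc / 2)) in H; [| lra].
    replace (Uc / 2 * (h / (Uc / 2))) with h in H by (field; lra). exact H.
  - apply Rle_ge, (Rmult_le_reg_l (Uc / 2)); [lra |].
    replace (Uc / 2 * (h / (Uc / 2))) with h by (field; lra). exact H.
Qed.

(** Positivity of the temperature on the left is [h < Uc / gam]; for
    [3 <= gam] it already bounds the strength by [delta_spike]. *)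
Lemma delta_spike_iff {M Sm Sp c P m Uc h} :
  medium_ok M -> gas_relations M Sm Sp c P m Uc h ->
  3 <= gam M \/ shock_strength Sm Sp c <= delta_spike M <->
  2 * h <= heat_gap M Uc.
Proof.
  intros HM Hg. pose proof (strength_pos Hg) as Hh.
  pose proof (Uc_bound HM Hg) as HU. pose proof (strength_lt Hg) as Hlt.
  rewrite (shock_strength_eq HM Hg). unfold delta_spike, heat_gap.
  assert (Hgam : 1 < gam M) by apply HM.
  assert (HUg : 0 < Uc / gam M) by (apply Rdiv_lt_0_compat; lra).
  split.
  - intros [H | H].
    + replace (Uc * (gam M - 1) / gam M) with (Uc / gam M * (gam M - 1))
        by (field; lra). nra.
    + apply (Rmult_le_compat_l Uc) in H; [| lra].
      replace (Uc * (2 * h / Uc)) with (2 * h) in H by (field; lra).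
      replace (Uc * (gam M - 1) / gam M) with (Uc * ((gam M - 1) / gam M))
        by (field; lra). exact H.
  - intros H. right. apply (Rmult_le_reg_l Uc); [lra |].
    replace (Uc * (2 * h / Uc)) with (2 * h) by (field; lra).
    replace (Uc * ((gam M - 1) / gam M)) with (Uc * (gam M - 1) / gam M)
      by (field; lra). exact H.
Qed.

(** At a regular sonic point [n = g_c], and [n] increases strictly from there to
    [g(theta_+)]: the end temperature exceeds the sonic one, i.e.
    [h < heat_gap]. *)
Lemma strong_shock_jumps {M Sm Sp c P m Uc h} s : medium_ok M -> state_ok Sp ->
  shock_profile M Sm Sp c P -> gas_relations M Sm Sp c P m Uc h ->
  transition (jumps P) (fun x => u P x - c - Uc) s ->
  heat_gap M Uc <= h -> In s (jumps P).
Proof.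
  intros HM HSp HP Hg T Hgap.
  pose proof (reduced_profile HM HP Hg) as D.
  destruct T as [_ [_ [HJ | [HJ Hv]]]]; [exact HJ | exfalso].
  destruct (sonic_point s D HJ Hv) as [Hn [_ Hw]].
  pose proof (n_incr_strict s (s + 1) D ltac:(lra) Hw) as Hn1.
  rewrite Hn in Hn1.
  pose proof (strength_pos Hg) as Hh.
  assert (Ht : gas_temp M Uc (- h) <= gas_temp M Uc 0).
  { apply gas_temp_le; [exact HM |]. nra. }
  rewrite <- (right_temp Hg) in Ht.
  assert (He : emission M (temperature Sp) <= emission M (gas_temp M Uc 0))
    by (apply emission_incr_le; [exact HM | split; [apply HSp | exact Ht]]).
  destruct HP as [_ [_ [_ [_ [_ [_ [_ [_ [Ln _]]]]]]]]].
  destruct (is_lim_p_eps _ _ Ln (n P (s + 1) - emission M (temperature Sp)))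
    as [B HB]; [lra |].
  pose proof (Rmax_l B (s + 1)). pose proof (Rmax_r B (s + 1)).
  specialize (HB (Rmax B (s + 1) + 1) ltac:(lra)). apply Rabs_def2 in HB.
  pose proof (n_incr (s + 1) (Rmax B (s + 1) + 1) D ltac:(lra)). lra.
Qed.

(** The temperature peaks where [v = U - Uc] passes through the maximizer
    [- heat_gap / 2] of [gas_temp], or behind the jump when that value is
    skipped. *)
Lemma temperature_peak {M Sm Sp c P m Uc h} : medium_ok M ->
  shock_profile M Sm Sp c P -> gas_relations M Sm Sp c P m Uc h ->
  heat_gap M Uc < 2 * h ->
  exists x0 v0,
    internal_absolute_max (theta P) (temperature Sm) (temperature Sp) x0 v0 /\
    (In x0 (jumps P) \/ (~ In x0 (jumps P) /\ theta P x0 = v0)).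
Proof.
  intros HM HP Hg Hbig.
  pose proof (reduced_profile HM HP Hg) as D.
  pose proof (fun z => @jump_states M Sm Sp c P m Uc h z HM HP Hg) as HJS.
  destruct (transition_exists D) as [s T].
  pose proof (strength_pos Hg) as Hh. pose proof (Uc_bound HM Hg) as HU.
  pose proof (heat_gap_pos M Uc HM ltac:(lra)) as Hgap.
  destruct HP as [[Hc _] [_ [_ [_ [_ [_ [Lup _]]]]]]].
  set (v := fun x => u P x - c - Uc) in *. set (g := heat_gap M Uc) in *.
  assert (Hvd := fun x y => v_strict_after s x y D T).
  assert (Hvm := fun x y => v_decr s x y D T).
  assert (Hvb := fun x => v_bounds x D).
  assert (T' := T). destruct T' as [HS [HB Hat]].
  assert (Hvp : forall e, - h < e -> exists B, forall y, B < y -> v y < e).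
  { intros e He. destruct (is_lim_p_eps _ _ Lup (e + h)) as [B HB']; [lra |].
    exists B. intros y Hy. specialize (HB' y Hy). apply Rabs_def2 in HB'.
    rewrite (right_velocity Hg) in HB'. unfold v. lra. }
  (* Every one-sided value of [theta] is [gas_temp] of one of [v]. *)
  assert (Hval : forall x t, one_sided_value (theta P) x t ->
    (~ In x (jumps P) /\ t = gas_temp M Uc (v x)) \/
    (x = s /\ exists q, 0 < q /\ left_lim v x q /\ right_lim v x (- q) /\
       (t = gas_temp M Uc q \/ t = gas_temp M Uc (- q)))).
  { intros x t Ht. destruct (classic (In x (jumps P))) as [HJ | HJ].
    - right. split.
      + destruct (Rtotal_order x s) as [L | [L | L]]; [| exact L |].
        * destruct (HS x L); contradiction.
        * destruct (HB x L); contradiction.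
      + destruct (HJS x HJ) as [q [rl [rr [Hq [_ [_ [Lul [Lur [Ltl [Ltr _]]]]]]]]]].
        exists q. split; [exact Hq |].
        split; [| split; [| apply (one_sided_value_jump _ _ _ _ _ Ltl Ltr Ht)]].
        * unfold left_lim, v in *.
          replace q with (c + Uc + q - c - Uc) by ring. limits.
        * unfold right_lim, v in *.
          replace (- q) with (c + Uc - q - c - Uc) by ring. limits.
    - left. split; [exact HJ |].
      transitivity (theta P x); [| apply (temp_eq Hg x HJ)].
      apply one_sided_value_continuous; [apply Hc, HJ | exact Ht]. }
  assert (Hright : forall q x, right_lim v s (- q) -> s < x -> v x < - q).
  { intros q x Lq Hx.
    apply Rlt_le_trans with (v ((s + x) / 2)); [apply Hvd; lra |].
    apply (right_lim_ge v ((s + x) / 2) s); [lra | exact Lq |].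
    intros y Hy. left. apply Hvd; lra. }
  rewrite (left_temp Hg), (right_temp Hg).
  destruct (classic (exists y, s < y /\ - g / 2 <= v y)) as [[y [Hy Hvy]] | Hno].
  - assert (Hx0 : exists x0, s < x0 /\ v x0 = - g / 2).
    { destruct Hvy as [Hvy | Hvy]; [| exists y; auto].
      destruct (Hvp (- g / 2)) as [B HB']; [lra |].
      pose proof (Rmax_l y B). pose proof (Rmax_r y B).
      specialize (HB' (Rmax y B + 1) ltac:(lra)).
      destruct (ivt (fun x => v x - - g / 2) y (Rmax y B + 1)) as [z [Hz E]].
      - lra.
      - intros x Hx. destruct (HB x) as [HxJ _]; [lra |].
        pose proof (v_cont D x HxJ) as Cv. unfold continuous in *. limits.
      - nra.
      - exists z. split; lra. }
    clear y Hy Hvy. destruct Hx0 as [x0 [Hx0 Ev]].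
    destruct (HB x0 Hx0) as [HxJ _].
    assert (Hpk : forall V, V <> - g / 2 -> gas_temp M Uc V < gas_temp M Uc (- g / 2)).
    { intros V HV. apply gas_temp_lt; [exact HM |]. fold g.
      replace ((V - - g / 2) * (- g / 2 + V + g)) with ((V + g / 2) ^ 2) by field.
      apply pow2_gt_0. lra. }
    assert (Et : theta P x0 = gas_temp M Uc (- g / 2)).
    { rewrite <- Ev. apply (temp_eq Hg x0 HxJ). }
    assert (Ct : continuous (theta P) x0) by apply Hc, HxJ.
    exists x0, (theta P x0). split; [| right; auto].
    rewrite Et. split; [| split; [| split; [| split; apply Hpk; lra]]].
    + rewrite <- Et. left. apply (continuous_one_sided _ _ Ct).
    + intros t Ht. rewrite (one_sided_value_continuous _ _ _ Ct Ht), Et. lra.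
    + intros x t Hne Ht.
      destruct (Hval x t Ht) as [[HJ ->] | [-> [q [Hq [_ [Lr Hq']]]]]].
      * apply Hpk. intros E.
        destruct (Rlt_le_dec s x) as [L | L].
        -- destruct (Rtotal_order x x0) as [L' | [L' | L']]; [| contradiction |].
           ++ specialize (Hvd x x0 L L'). lra.
           ++ specialize (Hvd x0 x Hx0 L'). lra.
        -- assert (0 <= v x); [| lra].
           destruct L as [L | ->].
           ++ destruct (HS x L). lra.
           ++ destruct Hat as [Hin | [_ Z]]; [contradiction | lra].
      * specialize (Hright q x0 Lr Hx0).
        destruct Hq' as [-> | ->]; apply Hpk; lra.
  - assert (Hlow : forall y, s < y -> v y < - g / 2).
    { intros y Hy. apply Rnot_le_lt. intros Hle. apply Hno. exists y. auto. }
    assert (HsJ : In s (jumps P)).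
    { destruct Hat as [HJ | [HJ Hv]]; [exact HJ | exfalso].
      destruct (continuous_eps v s (v_cont D s HJ) (g / 2)) as [d [Hd H]]; [lra |].
      specialize (H (s + d / 2) ltac:(apply Rabs_def1; lra)).
      apply Rabs_def2 in H. specialize (Hlow (s + d / 2) ltac:(lra)). lra. }
    destruct (HJS s HsJ) as [q [rl [rr [Hq [_ [_ [Lul [Lur [Ltl [Ltr _]]]]]]]]]].
    assert (Ll : left_lim v s q).
    { unfold left_lim, v in *. replace q with (c + Uc + q - c - Uc) by ring. limits. }
    assert (Lr : right_lim v s (- q)).
    { unfold right_lim, v in *.
      replace (- q) with (c + Uc - q - c - Uc) by ring. limits. }
    assert (Hqg : - q <= - g / 2).
    { apply (right_lim_le v (s + 1) s); [lra | exact Lr |].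
      intros y Hy. left. apply Hlow. lra. }
    assert (Hpk1 : forall V, q <= V -> gas_temp M Uc V < gas_temp M Uc (- q)).
    { intros V HV. apply gas_temp_lt; [exact HM |]. fold g.
      apply Rmult_lt_0_compat; lra. }
    assert (Hpk2 : forall V, V < - q -> gas_temp M Uc V < gas_temp M Uc (- q)).
    { intros V HV. apply gas_temp_lt; [exact HM |]. fold g.
      replace ((V - - q) * (- q + V + g)) with ((- q - V) * (q - V - g)) by ring.
      apply Rmult_lt_0_compat; lra. }
    assert (Hleft : forall x, x < s -> q <= v x).
    { intros x Hx. apply (left_lim_le v x s); [lra | exact Ll |].
      intros y Hy. apply Hvm; try apply HS; lra. }
    exists s, (gas_temp M Uc (- q)). split; [| left; exact HsJ].
    split; [right; exact Ltr | split; [| split; [| split]]].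
    + intros t Ht. destruct (one_sided_value_jump _ _ _ _ _ Ltl Ltr Ht) as [-> | ->].
      * left. apply Hpk1. lra.
      * lra.
    + intros x t Hne Ht.
      destruct (Hval x t Ht) as [[HJ ->] | [E _]]; [| contradiction].
      destruct (Rtotal_order x s) as [L | [L | L]]; [| contradiction |].
      * apply Hpk1, Hleft, L.
      * apply Hpk2, Hright; assumption.
    + apply Hpk1. apply Rle_trans with (v (s - 1)); [apply Hleft; lra |].
      apply Hvb, HS. lra.
    + apply Hpk2. apply Rle_lt_trans with (v (s + 1)).
      * apply Hvb, HB. lra.
      * apply Hright; [exact Lr | lra].
Qed.

Lemma velocity_decreasing {M Sm Sp c P m Uc h} x y : medium_ok M ->
  shock_profile M Sm Sp c P -> gas_relations M Sm Sp c P m Uc h ->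
  ~ In x (jumps P) -> ~ In y (jumps P) -> x < y -> u P y <= u P x.
Proof.
  intros HM HP Hg Hx Hy Hxy.
  pose proof (reduced_profile HM HP Hg) as D.
  destruct (transition_exists D) as [s T].
  pose proof (v_decr s x y D T Hx Hy Hxy). lra.
Qed.

Theorem theorem1p2 (M : medium) (Sm Sp : state) (c : R) (P : profile)
    (hM : medium_ok M) (hSm : state_ok Sm) (hSp : state_ok Sp)
    (hRH : rankine_hugoniot M Sm Sp c)
    (hE : one_shock_entropy M Sm Sp c)
    (hP : shock_profile M Sm Sp c P) :
  (gam M < 2 -> shock_strength Sm Sp c >= delta_jump M ->
     exists x, In x (jumps P) /\ jump_discontinuity (rho P) x /\
       jump_discontinuity (u P) x /\ jump_discontinuity (theta P) x) /\
  (monotone_off (jumps P) (rho P) /\ monotone_off (jumps P) (u P)) /\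
  (monotone_off (jumps P) (theta P) <->
     (3 <= gam M \/ shock_strength Sm Sp c <= delta_spike M)) /\
  (~ (3 <= gam M \/ shock_strength Sm Sp c <= delta_spike M) ->
     exists x0 v0,
       internal_absolute_max (theta P) (temperature Sm) (temperature Sp) x0 v0 /\
       (In x0 (jumps P) \/ (~ In x0 (jumps P) /\ theta P x0 = v0))).
Proof.
  destruct (gas_relations_exist M Sm Sp c P hM hSm hSp hE hP) as [m [Uc [h Hg]]].
  pose proof (strength_pos Hg) as Hh. pose proof (Uc_bound hM Hg) as HU.
  pose proof (heat_gap_pos M Uc hM ltac:(lra)) as Hgap.
  pose proof (reduced_profile hM hP Hg) as D.
  assert (Hdec := fun x y => velocity_decreasing x y hM hP Hg).
  split; [| split; [split | split]].
  - intros _ Hs. apply (delta_jump_iff hM Hg) in Hs.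
    destruct (transition_exists D) as [s T].
    pose proof (strong_shock_jumps s hM hSp hP Hg T Hs) as HJ.
    destruct (jump_states s hM hP Hg HJ)
      as [q [rl [rr [Hq [Lrl [Lrr [Lul [Lur [Ltl [Ltr [Hne _]]]]]]]]]]].
    exists s. split; [exact HJ | split; [| split]].
    + exists rl, rr. auto.
    + exists (c + Uc + q), (c + Uc - q). repeat split; auto. lra.
    + exists (gas_temp M Uc q), (gas_temp M Uc (- q)). repeat split; auto.
      apply Rlt_not_eq, gas_temp_lt; [exact hM |].
      apply Rmult_lt_0_compat; lra.
  - left. intros x y Hx Hy Hxy.
    specialize (Hdec x y Hx Hy Hxy).
    pose proof (mass_flux Hg x Hx) as Ex. pose proof (mass_flux Hg y Hy) as Ey.
    pose proof (mass_pos Hg) as Hm.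
    pose proof (proj1 (v_bounds x D Hx)) as Bx.
    pose proof (proj1 (v_bounds y D Hy)) as By. cbv beta in Bx, By.
    apply Rnot_lt_le. intros Hlt.
    assert (0 < rho P y) by apply hP, Hy.
    assert (rho P y * (u P y - c) < rho P x * (u P x - c)); [| lra].
    apply Rlt_le_trans with (rho P x * (u P y - c)).
    + apply Rmult_lt_compat_r; lra.
    + apply Rmult_le_compat_l; lra.
  - right. exact Hdec.
  - rewrite (delta_spike_iff hM Hg). split.
    + intros Hmon. apply Rnot_lt_le. intros Hlt.
      destruct (temperature_peak hM hP Hg Hlt) as [x0 [v0 [Hmax _]]].
      destruct hP as [_ [_ [_ [_ [[_ [_ [Lm _]]] [_ [_ [Lp _]]]]]]]].
      exact (internal_max_not_monotone _ _ _ _ _ _ Lm Lp Hmax Hmon).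
    + intros Hle. left. intros x y Hx Hy Hxy.
      specialize (Hdec x y Hx Hy Hxy).
      rewrite (temp_eq Hg x Hx), (temp_eq Hg y Hy).
      pose proof (proj1 (v_bounds x D Hx)) as Bx.
      pose proof (proj1 (v_bounds y D Hy)) as By. cbv beta in Bx, By.
      apply gas_temp_le; [exact hM |]. apply Rmult_le_pos; lra.
  - rewrite (delta_spike_iff hM Hg). intros Hn.
    apply (temperature_peak hM hP Hg). lra.
Qed.
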